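(* Let $u\in\mathrm{BMOA}(\mathbb T)$ and let $s>0$ be a singular value of $H_u$, i.e. $E_H(s):=\operatorname{Ker}(H_u^2-s^2I)\neq\{0\}$. Then there exist an inner function $\theta$ and an isometric multiplier $p\in\mathcal H^2(\mathbb T)$ on $\operatorname{Ran}H_\theta$ such that $$E_H(s)=p\operatorname{Ran}H_\theta .$$ Moreover $p$ and $\theta$ can be chosen such that $H_u(p)=s\theta p$, and in this case $$H_uT_p=sT_pH_\theta\quad\text{on }\operatorname{Ran}H_\theta,$$ i.e. $H_u(pf)=s\,p\,\theta\overline f$ for every $f\in\operatorname{Ran}H_\theta$.
   Context: $\mathcal H^2=\mathcal H^2(\mathbb T)\subset L^2(\mathbb T)$ is the Hardy space (identified with holomorphic functions on the unit disk $\mathbb D$), $P:L^2(\mathbb T)\to\mathcal H^2$ the orthogonal (Szegő) projection. For $u\in\mathrm{BMOA}(\mathbb T)$ the anti-linear Hankel operator is $H_uf=P(u\overline f)$, $f\in\mathcal H^2$; it is bounded. For an inner function $\theta$, $H_\theta^2$ is the orthogonal projection onto $\operatorname{Ran}H_\theta=\mathcal K_{z\theta}:=\mathcal H^2\ominus z\theta\mathcal H^2=\{f\in\mathcal H^2:\theta\overline f\in\mathcal H^2\}$, and $H_\theta f=\theta\overline f$ for $f\in\operatorname{Ran}H_\theta$. If $F\subset\mathcal H^2$ is a closed subspace, a holomorphic function $p$ on $\mathbb D$ is an isometric multiplier on $F$ if $pf\in\mathcal H^2$ and $\|pf\|=\|f\|$ for all $f\in F$; then $pF:=\{pf:f\in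 F\}$. $T_a$ denotes the Toeplitz operator $T_af=P(af)$; for an isometric multiplier $p$ on $F$, $T_pf=pf$ for $f\in F$. *)

(* Defs.v *)
(* Hardy space H^2(T) modelled by Taylor/Fourier coefficient
   sequences (nat -> Cx), Cx = R*R. *)
From Stdlib Require Import Reals.
Open Scope R_scope.

Definition Cx : Type := (R * R)%type.
Definition C0 : Cx := (0, 0).
Definition C1 : Cx := (1, 0).
Definition Cadd (a b : Cx) : Cx := (fst a + fst b, snd a + snd b).
Definition Cmul (a b : Cx) : Cx :=
  (fst a * fst b - snd a * snd b, fst a * snd b + snd a * fst b).
Definition Cconj (a : Cx) : Cx := (fst a, - snd a).
Definition Cnorm2 (a : Cx) : R := fst a * fst a + snd a * snd a.
Definition Rscal (r : R) (a : Cx) : Cx := (r * fst a, r * snd a).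

Definition Cseries (g : nat -> Cx) (l : Cx) : Prop :=
  infinite_sum (fun k => fst (g k)) (fst l) /\
  infinite_sum (fun k => snd (g k)) (snd l).

Definition Csumfin (g : nat -> Cx) (n : nat) : Cx :=
  (sum_f_R0 (fun k => fst (g k)) n, sum_f_R0 (fun k => snd (g k)) n).

Definition H2 (f : nat -> Cx) : Prop :=
  exists l, infinite_sum (fun n => Cnorm2 (f n)) l.

(* product of holomorphic functions on D = Cauchy product of coefficients *)
Definition cprod (p f : nat -> Cx) : nat -> Cx :=
  fun n => Csumfin (fun k => Cmul (p k) (f (n - k)%nat)) n.

(* Anti-linear Hankel operator H_u f = P(u conj f), as a (functional)
   relation:  (H_u f)_n = sum_{k>=0} u_{n+k} conj(f_k). *)
Definition Hankel (u f g : nat -> Cx) : Prop :=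
  forall n, Cseries (fun k => Cmul (u (n + k)%nat) (Cconj (f k))) (g n).

(* BMOA via boundedness of H_u on H^2 (Nehari-Fefferman) *)
Definition BMOA (u : nat -> Cx) : Prop :=
  H2 u /\ exists M : R, forall f, H2 f ->
    exists g, Hankel u f g /\ forall lf lg,
      infinite_sum (fun n => Cnorm2 (f n)) lf ->
      infinite_sum (fun n => Cnorm2 (g n)) lg -> lg <= M * lf.

(* inner function: theta in H^2 with |theta|^2 = 1 a.e. on T, i.e. all Fourier
   coefficients of |theta|^2 vanish except the 0-th which is 1:
   sum_n theta_n conj(theta_{n+k}) = delta_{k,0}  (k >= 0; k<0 by conjugation) *)
Definition inner (theta : nat -> Cx) : Prop :=
  H2 theta /\ forall k : nat,
    Cseries (fun n => Cmul (theta n) (Cconj (theta (n + k)%nat)))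
            (match k with O => C1 | _ => C0 end).

Definition RanH (theta f : nat -> Cx) : Prop :=
  exists g, H2 g /\ Hankel theta g f.

Definition isometric_multiplier (p : nat -> Cx) (F : (nat -> Cx) -> Prop) : Prop :=
  forall f, F f -> H2 (cprod p f) /\
    forall l, infinite_sum (fun n => Cnorm2 (f n)) l ->
              infinite_sum (fun n => Cnorm2 (cprod p f n)) l.

Definition EH (u : nat -> Cx) (s : R) (f : nat -> Cx) : Prop :=
  H2 f /\ exists g, Hankel u f g /\ Hankel u g (fun n => Rscal (s * s) (f n)).

(* Main.v *)
(* Put [H := H_u / s], so that [E_H(s)] is the fixed space [E] of [H^2], on which [H] is
   an antilinear isometric involution.  Let [m] be the smallest order of
   vanishing at [0] of elements of [E], and [p] the unit vector of [E] orthogonal to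
   [{g in E : g_m = 0}].  The symmetry of [H] and [H S = S^* H] make [E] nearly
   invariant, so Hitt's operator [R g = S^* (g - <g,p> p)] acts on [E], and
   [g = p c(g)] with [c(g)_k = <R^k g, p>] and [|g|^2 = sum_{k<N} |c(g)_k|^2 + |R^N g|^2].

   With [q = H p] and [theta = c(q)] one has [q = p theta].  The same symmetry shows
   that [q] and [p] have the same autocorrelation, which forces [|theta| >= 1], so that
   [R^N q -> 0].  Since moreover [H R H = R^*] on [E], this gives
   [c(H g) = H_theta (c g)], whence [theta] is inner and [g |-> c(g)] is a unitary from
   [E] onto [Ran H_theta].

   For the intertwining relation, let [w = p^-1 H_u (p f) / s] for [f] in [Ran H_theta].
   Both [f |-> w] and [H_theta] are symmetric and transform alike under [S^*], so they
   agree on all [S^*^k theta], hence their difference [x] satisfies [H_theta x = 0],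
   that is [x = 0]. *)
From Stdlib Require Import Reals Lra Lia Classical ClassicalEpsilon.
From Stdlib Require Import FunctionalExtensionality ProofIrrelevance.
From Coquelicot Require Import Coquelicot.
Require Import Defs.
Open Scope R_scope.

Notation "z ^*" := (Defs.Cconj z) (at level 2, format "z ^*") : C_scope.

(** No boundary values are used: having modulus one on the circle is read off from autocorrelations,
    and the quotient of [q] by [p] is first of all a formal power series. The obstacle is that
    [g |-> c(g)] is a priori only a contraction, since nothing forces the remainders [R^N g] to
    vanish in the limit for a general [g]. For [q] alone, [|q| = 1] leaves
    [|R^N q|^2 = 1 - sum_{k<N} |theta_k|^2], so the remainder vanishes in the limit exactly when
    [|theta| = 1]; contraction gives one inequality, autocorrelation the other. This single orbit
    suffices: in [<R^k q, g>] the remainder is at most [|R^(N+k) q| |g|], and because [H R H] is the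
    adjoint of [R], these numbers are precisely the coefficients of [c(H g)]. The second half of the
    theorem concerns every admissible pair, not only the constructed one, so it has to be derived
    from the hypotheses on the pair alone. *)

Lemma choice {A B : Type} (P : A -> B -> Prop) :
  (forall x, exists y, P x y) -> exists f, forall x, P x (f x).
Proof.
  intro h. exists (fun x => proj1_sig (constructive_indefinite_description _ (h x))).
  intro x. apply proj2_sig.
Qed.

Ltac cring := apply injective_projections; simpl; ring.

(** * Complex scalars and squared moduli *)

Lemma Cnorm2_ge0 (a : C) : 0 <= Cnorm2 a.
Proof. unfold Cnorm2; nra. Qed.

Lemma Cnorm2_mult (a b : C) : Cnorm2 (a * b)%C = Cnorm2 a * Cnorm2 b.
Proof. unfold Cnorm2; simpl; ring. Qed.

Lemma Cnorm2_conj (a : C) : Cnorm2 (a^*)%C = Cnorm2 a.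
Proof. unfold Cnorm2; simpl; ring. Qed.

Lemma Cnorm2_plus_le (a b : C) : Cnorm2 (a + b)%C <= 2 * Cnorm2 a + 2 * Cnorm2 b.
Proof.
  unfold Cnorm2; simpl.
  assert (H := Rle_0_sqr (fst a - fst b)). assert (H' := Rle_0_sqr (snd a - snd b)).
  unfold Rsqr in *. lra.
Qed.

Lemma Cnorm2_eq0 (a : C) : Cnorm2 a = 0 -> a = RtoC 0.
Proof.
  unfold Cnorm2; intro h. assert (fst a = 0) by nra. assert (snd a = 0) by nra.
  apply injective_projections; simpl; auto.
Qed.

Lemma Cconj_mul_self (a : C) : (a^* * a)%C = RtoC (Cnorm2 a).
Proof. unfold Cnorm2; cring. Qed.

Lemma Cconj_conj (a : C) : (a^*)^*%C = a.
Proof. cring. Qed.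

(** * Square-summable sequences *)

(** Summability is bundled with the sequence so that, through [L2_eq], identities between vectors
    become Leibniz equalities and operators on the space are plain functions open to rewriting. *)
Record L2 := mkL2 { co :> nat -> C ; co_l2 : ex_series (fun n => Cnorm2 (co n)) }.

Lemma L2_eq (f g : L2) : (forall n, f n = g n) -> f = g.
Proof.
  destruct f as [f hf], g as [g hg]; simpl; intro h.
  assert (f = g) by (now apply functional_extensionality). subst.
  f_equal; apply proof_irrelevance.
Qed.

Ltac l2ext := let n := fresh "n" in apply L2_eq; intro n; simpl; try cring.

Lemma ex_series_Rle (a b : nat -> R) :
  (forall n, Rabs (a n) <= b n) -> ex_series b -> ex_series a.
Proof. intros h; apply (@ex_series_le R_AbsRing R_CompleteNormedModule a b h). Qed.

Lemma ex_series_Rplus (a b : nat -> R) :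
  ex_series a -> ex_series b -> ex_series (fun n => a n + b n).
Proof. apply (@ex_series_plus R_AbsRing R_NormedModule). Qed.

Lemma ex_series_Rscal (c : R) (a : nat -> R) :
  ex_series a -> ex_series (fun n => c * a n).
Proof. apply (@ex_series_scal R_AbsRing R_NormedModule). Qed.

Lemma l2add_ok (f g : L2) : ex_series (fun n => Cnorm2 (f n + g n)%C).
Proof.
  apply ex_series_Rle with (fun n => 2 * Cnorm2 (f n) + 2 * Cnorm2 (g n)).
  - intro n. rewrite Rabs_pos_eq by apply Cnorm2_ge0. apply Cnorm2_plus_le.
  - apply ex_series_Rplus; apply ex_series_Rscal; apply co_l2.
Qed.
Definition l2add (f g : L2) : L2 := mkL2 _ (l2add_ok f g).

Lemma l2scal_ok (a : C) (f : L2) : ex_series (fun n => Cnorm2 (a * f n)%C).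
Proof.
  apply ex_series_ext with (fun n => Cnorm2 a * Cnorm2 (f n)).
  - intro n. rewrite Cnorm2_mult. reflexivity.
  - apply ex_series_Rscal; apply co_l2.
Qed.
Definition l2scal (a : C) (f : L2) : L2 := mkL2 _ (l2scal_ok a f).

Lemma l2zero_ok : ex_series (fun _ : nat => Cnorm2 (RtoC 0)).
Proof. exists 0. apply is_series_Reals. intros e he; exists 0%nat; intros n _.
  rewrite (sum_eq _ (fun _ => 0)) by (intros; unfold Cnorm2; simpl; ring).
  rewrite sum_cte. unfold R_dist. rewrite Rmult_0_l, Rminus_diag, Rabs_R0. exact he. Qed.
Definition l2zero : L2 := mkL2 _ l2zero_ok.

Definition shseq (f : nat -> C) (n : nat) : C := match n with O => RtoC 0 | S k => f k end.

Lemma l2S_ok (f : L2) : ex_series (fun n => Cnorm2 (shseq f n)).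
Proof. apply ex_series_incr_1. simpl. apply co_l2. Qed.
Definition l2S (f : L2) : L2 := mkL2 _ (l2S_ok f).

Lemma l2B_ok (f : L2) : ex_series (fun n => Cnorm2 (f (S n))).
Proof. apply (ex_series_incr_1 (fun n => Cnorm2 (f n))). apply co_l2. Qed.
Definition l2B (f : L2) : L2 := mkL2 _ (l2B_ok f).

Declare Scope l2_scope.
Delimit Scope l2_scope with L2.
Bind Scope l2_scope with L2.
Infix "+" := l2add : l2_scope.
Infix "*" := l2scal : l2_scope.
Notation "f - g" := (l2add f (l2scal (RtoC (-1)) g)) : l2_scope.

(** * The inner product *)

Definition isC (a : nat -> C) (l : C) : Prop :=
  is_series (fun n => fst (a n)) (fst l) /\ is_series (fun n => snd (a n)) (snd l).

Lemma isC_Cseries a l : isC a l <-> Cseries a l.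
Proof. unfold isC, Cseries. now rewrite !is_series_Reals. Qed.

Lemma isC_unique a l l' : isC a l -> isC a l' -> l = l'.
Proof.
  intros [h1 h2] [h3 h4]. apply injective_projections.
  - rewrite <- (is_series_unique _ _ h1). now apply is_series_unique.
  - rewrite <- (is_series_unique _ _ h2). now apply is_series_unique.
Qed.

Lemma isC_ext a b l : (forall n, a n = b n) -> isC a l -> isC b l.
Proof.
  intros h [h1 h2]; split; eapply is_series_ext; eauto; intro n; simpl; now rewrite h.
Qed.

Lemma isC_plus a b l m : isC a l -> isC b m -> isC (fun n => a n + b n)%C (l + m)%C.
Proof. intros [h1 h2] [h3 h4]; split; simpl; apply (@is_series_plus R_AbsRing R_NormedModule); auto. Qed.

Lemma isC_scal c a l : isC a l -> isC (fun n => c * a n)%C (c * l)%C.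
Proof.
  intros [h1 h2]; split; simpl.
  - apply (@is_series_minus R_AbsRing R_NormedModule); apply (@is_series_scal_l R_AbsRing); auto.
  - apply (@is_series_plus R_AbsRing R_NormedModule); apply (@is_series_scal_l R_AbsRing); auto.
Qed.

Lemma isC_conj a l : isC a l -> isC (fun n => (a n)^*)%C (l^*)%C.
Proof. intros [h1 h2]; split; simpl; auto. apply (@is_series_opp R_AbsRing R_NormedModule); auto. Qed.

(** Linear in the first argument and conjugate-linear in the second. [Series] makes it total;
    [ip_isC] shows that the value is a genuine sum. *)
Definition ip (f g : L2) : C :=
  (Series (fun n => fst (f n * (g n)^*)%C), Series (fun n => snd (f n * (g n)^*)%C)).

(** Real and imaginary parts of the terms are dominated by [Cnorm2 (f n) + Cnorm2 (g n)]; the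
    squares collected below supply this inequality to [nra]. *)
Lemma ip_isC (f g : L2) : isC (fun n => f n * (g n)^*)%C (ip f g).
Proof.
  assert (h : ex_series (fun n => Cnorm2 (f n) + Cnorm2 (g n))).
  { apply ex_series_Rplus; apply co_l2. }
  split; unfold ip; simpl; apply Series_correct; (eapply ex_series_Rle; [|exact h]); intro n;
    unfold plus; simpl; unfold Cnorm2; apply Rabs_le; split;
    assert (Hs := Rle_0_sqr (fst (f n) - fst (g n)));
    assert (Ht := Rle_0_sqr (snd (f n) - snd (g n)));
    assert (Hu := Rle_0_sqr (fst (f n) + fst (g n)));
    assert (Hv := Rle_0_sqr (snd (f n) + snd (g n)));
    assert (Hw := Rle_0_sqr (fst (f n) - snd (g n)));
    assert (Hx := Rle_0_sqr (fst (f n) + snd (g n)));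
    assert (Hy := Rle_0_sqr (snd (f n) - fst (g n)));
    assert (Hz := Rle_0_sqr (snd (f n) + fst (g n)));
    unfold Rsqr in *; nra.
Qed.

Opaque ip.

Lemma ip_unique (f g : L2) l : isC (fun n => f n * (g n)^*)%C l -> ip f g = l.
Proof. intro h; eapply isC_unique; [apply ip_isC | exact h]. Qed.

Lemma ip_addl f g h : ip (f + g)%L2 h = (ip f h + ip g h)%C.
Proof.
  apply ip_unique. eapply isC_ext; [|apply isC_plus; apply ip_isC].
  intro n; cring.
Qed.

Lemma ip_scall a f h : ip (a * f)%L2 h = (a * ip f h)%C.
Proof.
  apply ip_unique. eapply isC_ext; [|apply isC_scal; apply ip_isC].
  intro n; cring.
Qed.

Lemma ip_conj (f g : L2) : ip f g = (ip g f)^*%C.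
Proof.
  apply ip_unique. eapply isC_ext; [|apply isC_conj; apply ip_isC].
  intro n; cring.
Qed.

Lemma ip_addr f g h : ip h (f + g)%L2 = (ip h f + ip h g)%C.
Proof. rewrite ip_conj, ip_addl, (ip_conj h f), (ip_conj h g). cring. Qed.

Lemma ip_scalr a f h : ip h (a * f)%L2 = (a^* * ip h f)%C.
Proof. rewrite ip_conj, ip_scall, (ip_conj h f). cring. Qed.

Lemma ip_S_r (f g : L2) : ip f (l2S g) = ip (l2B f) g.
Proof.
  apply ip_unique. destruct (ip_isC (l2B f) g) as [h1 h2]. split.
  - apply (is_series_decr_1 (fun n => fst (f n * (l2S g n)^*)%C)).
    match goal with |- is_series _ ?x => replace x with (fst (ip (l2B f) g)) end.
    exact h1. unfold plus, opp; simpl. ring.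
  - apply (is_series_decr_1 (fun n => snd (f n * (l2S g n)^*)%C)).
    match goal with |- is_series _ ?x => replace x with (snd (ip (l2B f) g)) end.
    exact h2. unfold plus, opp; simpl. ring.
Qed.

Lemma ip_S_l (f g : L2) : ip (l2S g) f = ip g (l2B f).
Proof. now rewrite ip_conj, ip_S_r, <- ip_conj. Qed.

Lemma l2B_S f : l2B (l2S f) = f.
Proof. now l2ext. Qed.

Lemma ip_SS (f g : L2) : ip (l2S f) (l2S g) = ip f g.
Proof. now rewrite ip_S_r, l2B_S. Qed.

Definition ns (f : L2) : R := fst (ip f f).

Lemma ip_self f : ip f f = RtoC (ns f).
Proof.
  apply injective_projections; [reflexivity|].
  assert (h := ip_conj f f). apply (f_equal snd) in h. simpl in *. lra.
Qed.

Lemma ns_is (f : L2) : is_series (fun n => Cnorm2 (f n)) (ns f).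
Proof.
  destruct (ip_isC f f) as [h _]. eapply is_series_ext; [|exact h].
  intro n; unfold Cnorm2; simpl; ring.
Qed.

Lemma series_nonneg_partial (a : nat -> R) l :
  (forall n, 0 <= a n) -> is_series a l -> forall N, sum_n a N <= l.
Proof.
  intros h hl N. apply (is_lim_seq_incr_compare (sum_n a) l).
  - exact hl.
  - intro n. rewrite sum_Sn. unfold plus; simpl. specialize (h (S n)). lra.
Qed.

Lemma co_le_ns (f : L2) n : Cnorm2 (f n) <= ns f.
Proof.
  assert (h := series_nonneg_partial _ _ (fun k => Cnorm2_ge0 (f k)) (ns_is f)).
  destruct n as [|n].
  - specialize (h O). rewrite sum_O in h. exact h.
  - specialize (h (S n)). rewrite sum_Sn in h. unfold plus in h; simpl in h.
    assert (0 <= sum_n (fun k => Cnorm2 (f k)) n); [|lra].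
    clear h; induction n as [|n IH]; [rewrite sum_O | rewrite sum_Sn; unfold plus; simpl];
      [apply Cnorm2_ge0 | assert (hh := Cnorm2_ge0 (f (S n))); lra].
Qed.

Lemma ns_ge0 f : 0 <= ns f.
Proof. eapply Rle_trans; [apply (Cnorm2_ge0 (f O)) | apply co_le_ns]. Qed.

Lemma ns_eq0 f : ns f = 0 -> f = l2zero.
Proof.
  intro h. apply L2_eq; intro n; simpl. apply Cnorm2_eq0.
  assert (h1 := co_le_ns f n). assert (h2 := Cnorm2_ge0 (f n)). lra.
Qed.

Lemma ns_add f g : ns (f + g)%L2 = ns f + ns g + 2 * fst (ip f g).
Proof.
  unfold ns. rewrite !ip_addl, !ip_addr, (ip_conj g f). simpl. ring.
Qed.

Lemma ns_scal a f : ns (a * f)%L2 = Cnorm2 a * ns f.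
Proof.
  unfold ns. rewrite ip_scall, ip_scalr, ip_self. unfold Cnorm2. simpl. ring.
Qed.

Lemma ns_S (f : L2) : ns (l2S f) = ns f.
Proof. unfold ns. now rewrite ip_SS. Qed.

Lemma l2_zero_scal f : (RtoC 0 * f)%L2 = l2zero.
Proof. l2ext. Qed.

Lemma ip_zerol f : ip l2zero f = RtoC 0.
Proof. rewrite <- (l2_zero_scal f), ip_scall. cring. Qed.

Lemma ip_zeror f : ip f l2zero = RtoC 0.
Proof. rewrite ip_conj, ip_zerol. cring. Qed.

Lemma cauchy_schwarz f g : Cnorm2 (ip f g) <= ns f * ns g.
Proof.
  destruct (Req_dec (ns g) 0) as [h|h].
  { rewrite (ns_eq0 _ h), ip_zeror. unfold ns. rewrite ip_zeror. unfold Cnorm2; simpl. lra. }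
  assert (hg := ns_ge0 g).
  (* This is the component of [f] orthogonal to [g], multiplied by [ns g] to avoid a division. *)
  assert (h1 := ns_ge0 (RtoC (ns g) * f + (- ip f g)%C * g)%L2).
  rewrite ns_add, !ns_scal, ip_scall, ip_scalr in h1.
  assert (h2 : 0 <= ns g * (ns f * ns g - Cnorm2 (ip f g))).
  { unfold Cnorm2 in *. simpl in h1. nra. }
  assert (0 < ns g) by lra. nra.
Qed.

(** The parallelogram law with the norm of the difference dropped; it replaces the triangle
    inequality, as only squared norms occur. *)
Lemma ns_add_le f g : ns (f + g)%L2 <= 2 * ns f + 2 * ns g.
Proof.
  assert (h := ns_ge0 (f - g)%L2). rewrite ns_add, ns_scal, ip_scalr in h.
  unfold Cnorm2 in h; simpl in h. rewrite ns_add. lra.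
Qed.

(** * Convergence *)

Definition Clim (a : nat -> C) (l : C) : Prop :=
  is_lim_seq (fun k => fst (a k)) (fst l) /\ is_lim_seq (fun k => snd (a k)) (snd l).

Definition tends (F : nat -> L2) (f : L2) : Prop :=
  is_lim_seq (fun k => ns (F k - f)%L2) 0.

Lemma Rlim_unique (a : nat -> R) (l l' : R) : is_lim_seq a l -> is_lim_seq a l' -> l = l'.
Proof.
  intros h h'. apply is_lim_seq_unique in h. apply is_lim_seq_unique in h'.
  rewrite h in h'. now injection h'.
Qed.

Lemma Rlim_eps (a : nat -> R) (l : R) :
  is_lim_seq a l <-> (forall e, 0 < e -> exists N, forall n, (N <= n)%nat -> Rabs (a n - l) < e).
Proof.
  rewrite <- is_lim_seq_spec. simpl. split.
  - intros h e he. destruct (h (mkposreal e he)) as [N hN]. exists N. exact hN.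
  - intros h [e he]. destruct (h e he) as [N hN]. exists N. exact hN.
Qed.

Lemma Rabs_lt_of_sq (x e : R) : 0 < e -> x * x < e * e -> Rabs x < e.
Proof.
  intros he h. rewrite <- (Rabs_pos_eq e) by lra. now apply Rsqr_lt_abs_0.
Qed.

Lemma Rlim_sq (a v : nat -> R) (l : R) :
  (forall k, (a k - l) * (a k - l) <= v k) -> is_lim_seq v 0 -> is_lim_seq a l.
Proof.
  rewrite !Rlim_eps. intros h hv e he.
  destruct (hv (e * e)) as [N hN]; [nra|]. exists N; intros n hn.
  specialize (hN n hn). specialize (h n). rewrite Rminus_0_r in hN.
  apply Rabs_def2 in hN. apply Rabs_lt_of_sq; lra.
Qed.

Lemma Clim_unique a l l' : Clim a l -> Clim a l' -> l = l'.
Proof.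
  intros [h1 h2] [h3 h4]. apply injective_projections; eapply Rlim_unique; eauto.
Qed.

Lemma Clim_ext a b l : (forall n, a n = b n) -> Clim a l -> Clim b l.
Proof.
  intros h [h1 h2]; split; eapply is_lim_seq_ext; eauto; intro n; simpl; now rewrite h.
Qed.

Lemma Clim_sq (a : nat -> C) (v : nat -> R) (l : C) :
  (forall k, Cnorm2 (a k - l)%C <= v k) -> is_lim_seq v 0 -> Clim a l.
Proof.
  intros h hv; split; (apply Rlim_sq with v; [|exact hv]); intro k; specialize (h k); clear hv;
    unfold Cnorm2 in h; simpl in h;
    assert (h1 := Rle_0_sqr (fst (a k) - fst l)); assert (h2 := Rle_0_sqr (snd (a k) - snd l));
    unfold Rsqr in *; lra.
Qed.

Lemma Clim_const (c : C) : Clim (fun _ => c) c.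
Proof. split; apply is_lim_seq_const. Qed.

Lemma Clim_plus a b l m : Clim a l -> Clim b m -> Clim (fun k => a k + b k)%C (l + m)%C.
Proof. intros [h1 h2] [h3 h4]; split; simpl; now apply is_lim_seq_plus'. Qed.

Lemma Clim_scal c a l : Clim a l -> Clim (fun k => c * a k)%C (c * l)%C.
Proof.
  intros [h1 h2]; split; simpl.
  - apply is_lim_seq_minus'; now apply (is_lim_seq_scal_l _ _ (Finite _)).
  - apply is_lim_seq_plus'; now apply (is_lim_seq_scal_l _ _ (Finite _)).
Qed.

Lemma l2_add_sub (f g : L2) : (f + (g - f))%L2 = g.
Proof. l2ext. Qed.

Lemma Rlim_zero_scal (v : nat -> R) c : is_lim_seq v 0 -> is_lim_seq (fun k => v k * c) 0.
Proof.
  intro h. replace (Finite 0) with (Rbar_mult 0 c) by (simpl; f_equal; ring).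
  now apply is_lim_seq_scal_r.
Qed.

Lemma tends_ip F f g : tends F f -> Clim (fun k => ip (F k) g) (ip f g).
Proof.
  intro h. apply Clim_sq with (fun k => ns (F k - f)%L2 * ns g).
  - intro k. replace (ip (F k) g - ip f g)%C with (ip (F k - f)%L2 g).
    apply cauchy_schwarz. rewrite ip_addl, ip_scall. cring.
  - now apply Rlim_zero_scal.
Qed.

Lemma tends_co F f n : tends F f -> Clim (fun k => F k n) (f n).
Proof.
  intro h. apply Clim_sq with (fun k => ns (F k - f)%L2); [|exact h].
  intro k. eapply Rle_trans; [|apply (co_le_ns _ n)]. apply Req_le. f_equal. simpl. cring.
Qed.

(** Expanding the square of [f + (F k - f)] expresses [ns (F k)] through [ns (F k - f)] and
    [ip (F k) f], whose limits are known. *)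
Lemma tends_ns F f : tends F f -> is_lim_seq (fun k => ns (F k)) (ns f).
Proof.
  intro h.
  apply is_lim_seq_ext with (fun k => ns f + ns (F k - f)%L2 + (2 * fst (ip (F k) f) - 2 * ns f)).
  - intro k. assert (h1 := ns_add f (F k - f)%L2).
    rewrite l2_add_sub, ip_addr, ip_scalr, ip_self, (ip_conj f (F k)) in h1. simpl in h1. lra.
  - set (v := fun k => ns f + ns (F k - f)%L2 + (2 * fst (ip (F k) f) - 2 * ns f)).
    replace (Finite (ns f)) with (Finite (ns f + 0 + (2 * fst (ip f f) - 2 * ns f)))
      by (f_equal; unfold ns; ring).
    unfold v.
    apply is_lim_seq_plus'; [apply is_lim_seq_plus'|apply is_lim_seq_minus'].
    + apply is_lim_seq_const.
    + exact h.
    + apply (is_lim_seq_scal_l _ 2 (Finite _)). apply (tends_ip F f f h).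
    + apply is_lim_seq_const.
Qed.

Lemma tends_dom M F f G g :
  (forall k, ns (G k - g)%L2 <= M * ns (F k - f)%L2) -> tends F f -> tends G g.
Proof.
  intros h hF. unfold tends.
  apply is_lim_seq_le_le with (fun _ => 0) (fun k => ns (F k - f)%L2 * M).
  - intro k; split; [apply ns_ge0|]. rewrite Rmult_comm. apply h.
  - apply is_lim_seq_const.
  - now apply Rlim_zero_scal.
Qed.

Lemma tends_map (op : L2 -> L2) M F f :
  (forall a b, ns (op a - op b)%L2 <= M * ns (a - b)%L2) ->
  tends F f -> tends (fun k => op (F k)) (op f).
Proof.
  intros h. apply tends_dom with M. intro k. apply h.
Qed.

Lemma tends_unique F f g : tends F f -> tends F g -> f = g.
Proof.
  intros h h'. apply L2_eq. intro n. eapply Clim_unique; apply tends_co; eauto.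
Qed.

Lemma tends_cauchy F f : tends F f ->
  forall e, 0 < e -> exists N, forall i j, (N <= i)%nat -> (N <= j)%nat -> ns (F i - F j)%L2 <= e.
Proof.
  intros h e he. apply Rlim_eps with (e := e / 4) in h; [|lra].
  destruct h as [N hN]. exists N. intros i j hi hj.
  assert (h1 := hN i hi). assert (h2 := hN j hj). rewrite Rminus_0_r in h1, h2.
  apply Rabs_def2 in h1. apply Rabs_def2 in h2.
  replace (F i - F j)%L2 with ((F i - f) + RtoC (-1) * (F j - f))%L2 by l2ext.
  assert (h3 := ns_add_le (F i - f)%L2 (RtoC (-1) * (F j - f))%L2).
  rewrite ns_scal in h3. unfold Cnorm2 in h3. simpl in h3. lra.
Qed.

Lemma tends_add F f G g :
  tends F f -> tends G g -> tends (fun k => F k + G k)%L2 (f + g)%L2.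
Proof.
  intros hF hG. unfold tends.
  apply is_lim_seq_le_le with (fun _ => 0)
    (fun k => ns (F k - f)%L2 * 2 + ns (G k - g)%L2 * 2).
  - intro k; split; [apply ns_ge0|].
    replace (F k + G k - (f + g))%L2 with ((F k - f) + (G k - g))%L2 by l2ext.
    assert (h := ns_add_le (F k - f)%L2 (G k - g)%L2). lra.
  - apply is_lim_seq_const.
  - replace (Finite 0) with (Finite (0 + 0)) by (f_equal; ring).
    apply is_lim_seq_plus'; now apply Rlim_zero_scal.
Qed.

Lemma tends_scal a F f : tends F f -> tends (fun k => a * F k)%L2 (a * f)%L2.
Proof.
  apply tends_map with (Cnorm2 a). intros x y.
  replace (a * x - a * y)%L2 with (a * (x - y))%L2 by l2ext.
  rewrite ns_scal. lra.
Qed.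

Lemma tends_S F f : tends F f -> tends (fun k => l2S (F k)) (l2S f).
Proof.
  apply tends_map with 1. intros x y.
  replace (l2S x - l2S y)%L2 with (l2S (x - y)%L2).
  rewrite ns_S. lra. apply L2_eq; intros [|n]; simpl; cring.
Qed.

(** Each partial sum of squares involves finitely many coordinates, so the bound [B] passes to the
    limit in [k] before the number of terms grows. *)
Lemma fatou (F : nat -> L2) (f : nat -> C) B :
  (forall n, Clim (fun k => F k n) (f n)) -> (forall k, ns (F k) <= B) ->
  exists g : L2, co g = f /\ ns g <= B.
Proof.
  intros hc hB.
  assert (hs : forall N, sum_n (fun n => Cnorm2 (f n)) N <= B).
  { intro N.
    assert (hl : is_lim_seq (fun k => sum_n (fun n => Cnorm2 (F k n)) N)
              (sum_n (fun n => Cnorm2 (f n)) N)).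
    { assert (ht : forall n, is_lim_seq (fun k => Cnorm2 (F k n)) (Cnorm2 (f n))).
      { intro n. destruct (hc n) as [h1 h2]. unfold Cnorm2.
        apply is_lim_seq_plus'; now apply is_lim_seq_mult'. }
      induction N as [|N IH].
      - rewrite sum_O. eapply is_lim_seq_ext; [|apply ht]. intro k; now rewrite sum_O.
      - rewrite sum_Sn. eapply is_lim_seq_ext; [|apply is_lim_seq_plus'; [apply IH|apply ht]].
        intro k. now rewrite sum_Sn. }
    apply (is_lim_seq_le _ (fun _ => B) _ _ ) with (2 := hl) (3 := is_lim_seq_const B).
    intro k. eapply Rle_trans; [|apply (hB k)].
    apply series_nonneg_partial; [intro; apply Cnorm2_ge0 | apply ns_is]. }
  assert (hex : ex_series (fun n => Cnorm2 (f n))).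
  { destruct (ex_finite_lim_seq_incr (sum_n (fun n => Cnorm2 (f n))) B) as [l hl].
    - intro n. rewrite sum_Sn. unfold plus; simpl. assert (h := Cnorm2_ge0 (f (S n))). lra.
    - exact hs.
    - now exists l. }
  exists (mkL2 f hex). split; [reflexivity|].
  apply (is_lim_seq_le (sum_n (fun n => Cnorm2 (f n))) (fun _ => B) (ns (mkL2 f hex)) B hs).
  - exact (ns_is (mkL2 f hex)).
  - apply is_lim_seq_const.
Qed.

Lemma complete (F : nat -> L2) :
  (forall e, 0 < e -> exists N, forall i j, (N <= i)%nat -> (N <= j)%nat -> ns (F i - F j)%L2 <= e) ->
  exists f, tends F f.
Proof.
  intro hF.
  assert (hc : forall n, exists l, Clim (fun k => F k n) l).
  { intro n.
    assert (hh : forall pr : C -> R, (forall a b : C, (pr a - pr b) * (pr a - pr b) <= Cnorm2 (a - b)%C) ->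
        exists l : R, is_lim_seq (fun k => pr (F k n)) l).
    { intros pr hpr. apply ex_lim_seq_cauchy_corr. intros [e he].
      destruct (hF (e * e / 2)) as [N hN]; [nra|]. exists N. intros i j hi hj.
      specialize (hN i j hi hj). assert (h1 := co_le_ns (F i - F j)%L2 n).
      specialize (hpr (F i n) (F j n)).
      replace ((F i - F j)%L2 n) with (F i n - F j n)%C in h1 by (simpl; cring).
      apply Rabs_lt_of_sq; [exact he|].
      eapply Rle_lt_trans; [exact hpr|]. eapply Rle_lt_trans; [exact h1|].
      eapply Rle_lt_trans; [exact hN|]. simpl. nra. }
    destruct (hh fst) as [x hx]. { intros a b. unfold Cnorm2; simpl.
      assert (h1 := Rle_0_sqr (fst a - fst b)). assert (h2 := Rle_0_sqr (snd a - snd b)).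
      unfold Rsqr in *; lra. }
    destruct (hh snd) as [y hy]. { intros a b. unfold Cnorm2; simpl.
      assert (h1 := Rle_0_sqr (fst a - fst b)). assert (h2 := Rle_0_sqr (snd a - snd b)).
      unfold Rsqr in *; lra. }
    exists (x, y). now split. }
  apply choice in hc. destruct hc as [f hf].
  (* Letting [j] tend to infinity in the Cauchy estimate, by [fatou], makes the difference of the
     pointwise limit and [F i] square-summable with the same bound. *)
  assert (key : forall e N, (forall i j, (N <= i)%nat -> (N <= j)%nat -> ns (F i - F j)%L2 <= e) ->
      forall i, (N <= i)%nat -> exists g : L2, co g = (fun n => f n - F i n)%C /\ ns g <= e).
  { intros e N hN i hi.
    apply fatou with (fun j => F (j + N)%nat - F i)%L2.
    - intro n. apply Clim_ext with (fun j => F (j + N)%nat n + (- F i n))%C.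
      { intro j. simpl. cring. }
      apply Clim_plus; [|apply Clim_const].
      split; [apply (is_lim_seq_incr_n (fun j => fst (F j n)) N)
             |apply (is_lim_seq_incr_n (fun j => snd (F j n)) N)]; apply hf.
    - intro j. apply hN; lia. }
  destruct (hF 1 Rlt_0_1) as [N0 hN0].
  destruct (key 1 N0 hN0 N0 (le_n _)) as [g [hg _]].
  assert (hfg : forall n, (g + F N0)%L2 n = f n) by (intro n; simpl; rewrite hg; cring).
  exists (g + F N0)%L2. apply Rlim_eps. intros e he.
  destruct (hF (e / 2)) as [N hN]; [lra|]. exists N. intros i hi.
  destruct (key _ _ hN i hi) as [g' [hg' hb]].
  replace (F i - (g + F N0))%L2 with (RtoC (-1) * g')%L2.
  - rewrite ns_scal, Rminus_0_r. unfold Cnorm2; simpl. rewrite Rabs_pos_eq.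
    lra. assert (h := ns_ge0 g'). lra.
  - apply L2_eq. intro n. specialize (hfg n). simpl in *. rewrite hg', <- hfg. cring.
Qed.

(** The projection theorem for a midpoint-convex set that need not be closed: the minimising
    sequence is returned with its limit [d], which may lie outside [A]. *)
Lemma min_norm (A : L2 -> Prop) :
  (exists a, A a) -> (forall a b, A a -> A b -> A (RtoC (1/2) * (a + b))%L2) ->
  exists F d, (forall k, A (F k)) /\ tends F d /\ forall a, A a -> ns d <= ns a.
Proof.
  intros [a0 ha0] hmid.
  (* The infimum of the squared norms is obtained as [- m], with [m] the supremum of their
     negatives. *)
  destruct (completeness (fun r => exists a, A a /\ r = - ns a)) as [m [hm1 hm2]].
  { exists 0. intros r [a [_ ->]]. assert (h := ns_ge0 a). lra. }
  { exists (- ns a0). now exists a0. }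
  assert (hinf : forall a, A a -> - m <= ns a).
  { intros a ha. assert (h : - ns a <= m) by (apply hm1; now exists a). lra. }
  assert (hap : forall k : nat, exists a, A a /\ ns a <= - m + / INR (S k)).
  { intro k. apply NNPP. intro hn.
    assert (hk : 0 < / INR (S k)) by (apply Rinv_0_lt_compat, lt_0_INR; lia).
    assert (m <= m - / INR (S k)); [|lra].
    apply hm2. intros r [a [ha ->]]. destruct (Rle_dec (ns a) (- m + / INR (S k))).
    - exfalso; apply hn; now exists a.
    - lra. }
  apply choice in hap. destruct hap as [F hF].
  destruct (complete F) as [d hd].
  { intros e he.
    (* The parallelogram law bounds [ns (F i - F j)] by [2 / (i+1) + 2 / (j+1)], hence by
       [4 / N]. *)
    destruct (archimed_cor1 (e / 4)) as [N [hN hN0]]; [lra|].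
    exists N. intros i j hi hj.
    destruct (hF i) as [ai bi], (hF j) as [aj bj].
    assert (h := hinf _ (hmid _ _ ai aj)).
    assert (hb : forall k, (N <= k)%nat -> / INR (S k) <= / INR N).
    { intros k hk. apply Rinv_le_contravar; [now apply lt_0_INR|apply le_INR; lia]. }
    assert (h1 := hb i hi). assert (h2 := hb j hj).
    rewrite ns_scal, ns_add in h. unfold Cnorm2 in h. simpl in h.
    rewrite ns_add, ns_scal, ip_scalr. unfold Cnorm2. simpl. lra. }
  exists F, d. split; [intro k; apply hF|]. split; [exact hd|].
  intros a ha. apply Rle_trans with (- m); [|now apply hinf].
  apply tends_ns in hd.
  apply (is_lim_seq_le (fun k => ns (F k)) (fun k => - m + / INR (S k)) (ns d) (- m)).
  - intro k. apply hF.
  - exact hd.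
  - replace (Finite (- m)) with (Finite (- m + 0)) by (f_equal; ring).
    apply is_lim_seq_plus'; [apply is_lim_seq_const|].
    apply (is_lim_seq_incr_1 (fun n => / INR n)).
    apply (is_lim_seq_inv INR p_infty). apply is_lim_seq_INR. discriminate.
Qed.

Lemma min_orth (d x : L2) : (forall c, ns d <= ns (d + c * x)%L2) -> ip d x = RtoC 0.
Proof.
  intro h. apply Cnorm2_eq0.
  assert (hx := ns_ge0 x).
  (* The optimal step would be [ip d x / ns x]; the added 1 covers [x = 0], and [t * ns x <= 1] is
     all that the estimate needs. *)
  set (t := / (1 + ns x)).
  assert (ht : t * (1 + ns x) = 1) by (unfold t; apply Rinv_l; lra).
  assert (ht0 : 0 < t) by (apply Rinv_0_lt_compat; lra).
  specialize (h (RtoC (- t) * ip d x)%C).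
  rewrite ns_add, ns_scal, ip_scalr, Cnorm2_mult in h.
  assert (h0 := Cnorm2_ge0 (ip d x)).
  set (z := ip d x) in *. unfold Cnorm2 in *. simpl in h.
  assert (h2 : 2 * t * (fst z * fst z + snd z * snd z)
    <= t * t * (fst z * fst z + snd z * snd z) * ns x) by lra.
  clear h. set (w := fst z * fst z + snd z * snd z) in *.
  assert (h3 : t * ns x <= 1) by nra.
  assert (h4 : t * w * (t * ns x) <= t * w * 1) by (apply Rmult_le_compat_l; nra).
  assert (h5 : t * w <= 0) by nra. assert (w <= 0) by nra. lra.
Qed.

(** * Standard basis and partial sums *)

Lemma l2e0_ok : ex_series (fun n => Cnorm2 (match n with O => RtoC 1 | _ => RtoC 0 end)).
Proof. apply ex_series_incr_1. exact l2zero_ok. Qed.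
Definition e0 : L2 := mkL2 _ l2e0_ok.

Definition Sn (k : nat) : L2 -> L2 := Nat.iter k l2S.
Definition Bn (k : nat) : L2 -> L2 := Nat.iter k l2B.
Definition en (k : nat) : L2 := Sn k e0.

Lemma co_Bn k (f : L2) n : Bn k f n = f (n + k)%nat.
Proof.
  revert n; induction k as [|k IH]; intro n; simpl; [now rewrite Nat.add_0_r|].
  fold (Bn k f). rewrite IH. f_equal. lia.
Qed.

Lemma Bn_S k (f : L2) : Bn k (l2B f) = Bn (S k) f.
Proof. apply L2_eq; intro n. rewrite !co_Bn. simpl. f_equal; lia. Qed.

Lemma ip_Sn_r k (f g : L2) : ip f (Sn k g) = ip (Bn k f) g.
Proof.
  revert f; induction k as [|k IH]; intro f; [reflexivity|].
  simpl. fold (Sn k g). rewrite ip_S_r, IH. now rewrite Bn_S.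
Qed.

Lemma ip_e0 (f : L2) : ip f e0 = f O.
Proof.
  apply ip_unique. split.
  - apply (is_series_decr_1 (fun n => fst (f n * (e0 n)^*)%C)).
    apply is_series_ext with (fun _ => 0); [intro n; simpl; ring|].
    match goal with |- is_series _ ?x => replace x with 0 end.
    + apply is_series_Reals. intros e he; exists 0%nat; intros n _.
      rewrite sum_cte. unfold R_dist. rewrite Rmult_0_l, Rminus_diag, Rabs_R0. exact he.
    + unfold plus, opp; simpl. ring.
  - apply (is_series_decr_1 (fun n => snd (f n * (e0 n)^*)%C)).
    apply is_series_ext with (fun _ => 0); [intro n; simpl; ring|].
    match goal with |- is_series _ ?x => replace x with 0 end.
    + apply is_series_Reals. intros e he; exists 0%nat; intros n _.
      rewrite sum_cte. unfold R_dist. rewrite Rmult_0_l, Rminus_diag, Rabs_R0. exact he.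
    + unfold plus, opp; simpl. ring.
Qed.

Lemma ip_en (f : L2) k : ip f (en k) = f k.
Proof. unfold en. rewrite ip_Sn_r, ip_e0, co_Bn. reflexivity. Qed.

Lemma ip_en_en i j : ip (en i) (en j) = if Nat.eq_dec i j then RtoC 1 else RtoC 0.
Proof.
  rewrite ip_en. unfold en. revert j; induction i as [|i IH]; intros [|j]; simpl; auto.
  fold (Sn i e0). rewrite IH. destruct (Nat.eq_dec i j), (Nat.eq_dec (S i) (S j)); auto; lia.
Qed.

(** Sums here and in [psum] run over [k < N], so that unlike [sum_n] they start from the empty
    sum. *)
Fixpoint lsum (F : nat -> L2) (N : nat) : L2 :=
  match N with O => l2zero | S n => (lsum F n + F n)%L2 end.

Fixpoint psum (a : nat -> C) (N : nat) : R :=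
  match N with O => 0 | S n => psum a n + Cnorm2 (a n) end.

Definition trunc (a : nat -> C) (N : nat) : L2 := lsum (fun k => (a k * en k)%L2) N.

Lemma psum_sum_n a N : psum a (S N) = sum_n (fun n => Cnorm2 (a n)) N.
Proof.
  induction N as [|N IH]; [rewrite sum_O; simpl; ring|].
  rewrite sum_Sn, <- IH. reflexivity.
Qed.

Lemma psum_le (f : L2) N : psum f N <= ns f.
Proof.
  destruct N as [|N]; [apply ns_ge0|]. rewrite psum_sum_n.
  apply series_nonneg_partial; [intro; apply Cnorm2_ge0|apply ns_is].
Qed.

Lemma psum_lim (f : L2) : is_lim_seq (psum f) (ns f).
Proof.
  apply is_lim_seq_incr_1.
  apply is_lim_seq_ext with (sum_n (fun n => Cnorm2 (f n))); [intro; now rewrite psum_sum_n|].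
  exact (ns_is f).
Qed.

Lemma l2_of_psum (a : nat -> C) B : (forall N, psum a N <= B) -> exists g : L2, co g = a /\ ns g <= B.
Proof.
  intro h.
  assert (hex : ex_series (fun n => Cnorm2 (a n))).
  { destruct (ex_finite_lim_seq_incr (sum_n (fun n => Cnorm2 (a n))) B) as [l hl].
    - intro n. rewrite sum_Sn. unfold plus; simpl. assert (h' := Cnorm2_ge0 (a (S n))). lra.
    - intro n. rewrite <- psum_sum_n. apply h.
    - now exists l. }
  exists (mkL2 a hex); split; [reflexivity|].
  apply (is_lim_seq_le (psum a) (fun _ => B) (ns (mkL2 a hex)) B h).
  - exact (psum_lim (mkL2 a hex)).
  - apply is_lim_seq_const.
Qed.

Lemma ip_lsum_zero (F : nat -> L2) g N :
  (forall k, (k < N)%nat -> ip (F k) g = RtoC 0) -> ip (lsum F N) g = RtoC 0.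
Proof.
  induction N as [|N IH]; intro h; simpl; [apply ip_zerol|].
  rewrite ip_addl, IH, h by auto. cring.
Qed.

(** Pythagoras. Orthogonality is asked only below [N], because [inner_hankel] applies this to a
    family that itself depends on [N]. *)
Lemma ns_lsum_orth (phi : nat -> L2) (d : R) (a : nat -> C) N :
  (forall i j, (i < N)%nat -> (j < N)%nat ->
     ip (phi i) (phi j) = if Nat.eq_dec i j then RtoC d else RtoC 0) ->
  ns (lsum (fun k => a k * phi k)%L2 N) = d * psum a N.
Proof.
  induction N as [|N IH]; intro h; simpl.
  - unfold ns. rewrite ip_zerol. simpl. ring.
  - rewrite ns_add, IH by (intros; apply h; lia). rewrite ip_lsum_zero.
    + rewrite ns_scal. unfold ns. rewrite h by lia. destruct (Nat.eq_dec N N) as [_|n]; [|now destruct n].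
      simpl. ring.
    + intros k hk. rewrite ip_scall, ip_scalr, h by lia. destruct (Nat.eq_dec k N); [lia|]. cring.
Qed.

Lemma ns_trunc a N : ns (trunc a N) = psum a N.
Proof. unfold trunc. rewrite (ns_lsum_orth en 1) by (intros; apply ip_en_en). ring. Qed.

Lemma ip_trunc_self (f : L2) N : ip f (trunc f N) = RtoC (psum f N).
Proof.
  unfold trunc. induction N as [|N IH]; simpl; [apply ip_zeror|].
  rewrite ip_addr, IH, ip_scalr, ip_en, Cconj_mul_self. cring.
Qed.

Lemma tends_trunc (f : L2) : tends (trunc f) f.
Proof.
  unfold tends. apply is_lim_seq_ext with (fun N => ns f - psum f N).
  - intro N. rewrite ns_add, ns_scal, ns_trunc, ip_scalr, ip_conj, ip_trunc_self.
    unfold Cnorm2; simpl. ring.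
  - replace (Finite 0) with (Finite (ns f - ns f)) by (f_equal; ring).
    apply is_lim_seq_minus'; [apply is_lim_seq_const|apply psum_lim].
Qed.

(** * Cauchy products *)

Lemma cprod_0 (p c : nat -> C) : cprod p c O = (p O * c O)%C.
Proof. unfold cprod, Csumfin. simpl. reflexivity. Qed.

(** From [p c = c_0 p + z p (c - c_0)/z]. This recursion, with [c] replaced by its backward shift,
    drives the inductions on coefficients below. *)
Lemma cprod_S (p c : nat -> C) n :
  cprod p c (S n) = (p (S n) * c O + cprod p (fun k => c (S k)) n)%C.
Proof.
  unfold cprod, Csumfin. rewrite !tech5.
  rewrite (sum_eq (fun k => fst (Cmul (p k) (c (S n - k)%nat)))
                  (fun k => fst (Cmul (p k) (c (S (n - k)))))).
  rewrite (sum_eq (fun k => snd (Cmul (p k) (c (S n - k)%nat)))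
                  (fun k => snd (Cmul (p k) (c (S (n - k)))))).
  - rewrite Nat.sub_diag. cring.
  - intros k hk. now rewrite Nat.sub_succ_l.
  - intros k hk. now rewrite Nat.sub_succ_l.
Qed.

Lemma cprod_plus_r (p c c' : nat -> C) n :
  cprod p (fun k => c k + c' k)%C n = (cprod p c n + cprod p c' n)%C.
Proof.
  revert c c'; induction n as [|n IH]; intros c c'; [rewrite !cprod_0 | rewrite !cprod_S, IH]; cring.
Qed.

Lemma cprod_scal_r (p c : nat -> C) (a : C) n :
  cprod p (fun k => a * c k)%C n = (a * cprod p c n)%C.
Proof.
  revert c; induction n as [|n IH]; intro c; [rewrite !cprod_0 | rewrite !cprod_S, IH]; cring.
Qed.

Lemma cprod_S_l (p c : nat -> C) n :
  cprod p c (S n) = (p O * c (S n) + cprod (fun k => p (S k)) c n)%C.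
Proof.
  revert c; induction n as [|n IH]; intro c.
  - rewrite cprod_S, !cprod_0. cring.
  - rewrite cprod_S, IH, cprod_S. cring.
Qed.

Lemma cprod_comm (p c : nat -> C) : cprod p c = cprod c p.
Proof.
  apply functional_extensionality. intro n. revert p c.
  induction n as [|n IH]; intros p c.
  - rewrite !cprod_0. cring.
  - rewrite cprod_S, cprod_S_l, IH. cring.
Qed.

Lemma cprod_shseq_r (p c : nat -> C) n : cprod p (shseq c) n = shseq (cprod p c) n.
Proof.
  destruct n as [|n]; [rewrite cprod_0 | rewrite cprod_S]; simpl; [cring|].
  change (fun k => c k) with c. cring.
Qed.

Lemma cprod_e0_r (p : nat -> C) n : cprod p e0 n = p n.
Proof.
  destruct n as [|n]; [rewrite cprod_0 | rewrite cprod_S]; simpl; [cring|].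
  replace (cprod p (fun _ => RtoC 0) n) with (RtoC 0); [cring|].
  induction n as [|n IH]; [rewrite cprod_0 | rewrite cprod_S, <- IH]; cring.
Qed.

Lemma cprod_low (p c : nat -> C) m :
  (forall j, (j < m)%nat -> p j = RtoC 0) ->
  (forall n, (n < m)%nat -> cprod p c n = RtoC 0) /\ cprod p c m = (p m * c O)%C.
Proof.
  intro h.
  assert (h1 : forall n c, (n < m)%nat -> cprod p c n = RtoC 0).
  { induction n as [|n IH]; intros c' hn; [rewrite cprod_0 | rewrite cprod_S, IH by lia];
    rewrite h by lia; cring. }
  split; [now auto|]. destruct m as [|m]; [apply cprod_0|].
  rewrite cprod_S, h1 by lia. cring.
Qed.

Lemma least (Q : nat -> Prop) : (exists n, Q n) -> exists n, Q n /\ forall j, (j < n)%nat -> ~ Q j.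
Proof.
  intros [n hn]. revert hn. induction n as [n IH] using (well_founded_induction Wf_nat.lt_wf).
  intro hn. destruct (classic (exists j, (j < n)%nat /\ Q j)) as [[j [hj hq]]|h].
  - exact (IH j hj hq).
  - exists n; split; [exact hn|]. intros j hj hq. apply h. now exists j.
Qed.

Lemma Cmul_eq0 (a b : C) : a <> RtoC 0 -> (a * b)%C = RtoC 0 -> b = RtoC 0.
Proof.
  intros ha h. apply Cnorm2_eq0. apply (f_equal Cnorm2) in h. rewrite Cnorm2_mult in h.
  replace (Cnorm2 (RtoC 0)) with 0 in h by (unfold Cnorm2; simpl; ring).
  apply Rmult_integral in h. destruct h as [h|h]; [|exact h].
  now apply Cnorm2_eq0 in h.
Qed.

(** Formal power series have no zero divisors: if [m] is the order of [p], coefficient [m] of the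
    product is [p_m c_0], so [c_0 = 0], and the argument repeats on the backward shift of [c]. *)
Lemma cprod_eq0 (p c : nat -> C) :
  (exists m, p m <> RtoC 0) -> (forall n, cprod p c n = RtoC 0) -> forall n, c n = RtoC 0.
Proof.
  intros hp hc n. apply least in hp. destruct hp as [m [hm hj]].
  assert (hlow : forall j, (j < m)%nat -> p j = RtoC 0).
  { intros j h. apply NNPP. now apply hj. }
  revert c hc. assert (hc0 : forall c, (forall n, cprod p c n = RtoC 0) -> c O = RtoC 0).
  { intros c hc. apply Cmul_eq0 with (p m); [exact hm|].
    rewrite <- (proj2 (cprod_low p c m hlow)). apply hc. }
  induction n as [|n IH]; intros c hc; [now apply hc0|].
  apply (IH (fun k => c (S k))). intro k. specialize (hc (S k)) as h.
  rewrite cprod_S, (hc0 c hc) in h. rewrite <- h. cring.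
Qed.

Lemma cprod_inj (p c c' : nat -> C) :
  (exists m, p m <> RtoC 0) -> (forall n, cprod p c n = cprod p c' n) -> forall n, c n = c' n.
Proof.
  intros hp h n.
  assert (h1 : (c n + (RtoC (-1) * c' n))%C = RtoC 0).
  { apply (cprod_eq0 p (fun n => c n + (RtoC (-1) * c' n))%C hp). intro k.
    rewrite cprod_plus_r, cprod_scal_r, h. cring. }
  replace (c n) with (c n + RtoC (-1) * c' n + c' n)%C by cring. rewrite h1. cring.
Qed.

(** * Bounded Hankel operators *)

(** For an antilinear operator, self-adjointness takes the form [ho_sym], without conjugation. No
    symbol is mentioned, so that the record serves [H_u], its multiple [H_u / s] and [H_theta]
    alike. *)
Record hankel_op (H : L2 -> L2) : Prop := {
  ho_add : forall f g, H (f + g)%L2 = (H f + H g)%L2;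
  ho_scal : forall a f, H (a * f)%L2 = (a^*%C * H f)%L2;
  ho_sym : forall f g, ip (H f) g = ip (H g) f;
  ho_shift : forall f, H (l2S f) = l2B (H f);
  ho_bdd : exists M, forall f, ns (H f) <= M * ns f }.

Lemma tends_ho H F f : hankel_op H -> tends F f -> tends (fun k => H (F k)) (H f).
Proof.
  intros hH. destruct (ho_bdd H hH) as [M hM]. apply tends_map with M. intros a b.
  replace (H a - H b)%L2 with (H (a - b)%L2); [apply hM|].
  rewrite (ho_add H hH), (ho_scal H hH). f_equal. l2ext.
Qed.

Lemma Clim_conj a l : Clim a l -> Clim (fun k => (a k)^*%C) (l^*)%C.
Proof.
  intros [h1 h2]; split; simpl; [exact h1|].
  now apply (is_lim_seq_opp (fun k => snd (a k)) (Finite _)).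
Qed.

Lemma tends_ip_r F f g : tends F f -> Clim (fun k => ip g (F k)) (ip g f).
Proof.
  intro h. rewrite (ip_conj g f).
  apply Clim_ext with (fun k => (ip (F k) g)^*%C).
  - intro k. now rewrite <- ip_conj.
  - apply Clim_conj. now apply tends_ip.
Qed.

(** The Hankel operator sends [z^k] to [Bn k u], so the left side is the image of the polynomial
    [trunc a N]; the two sides agree because [u (n + k)] is symmetric in [n] and [k]. *)
Lemma lsum_hankel (u : L2) (a : nat -> C) N n :
  lsum (fun k => (a k)^*%C * Bn k u)%L2 N n = ip (Bn n u) (trunc a N).
Proof.
  unfold trunc. induction N as [|N IH]; simpl; [now rewrite ip_zeror|].
  rewrite IH, ip_addr, ip_scalr, ip_en, !co_Bn. f_equal. f_equal. f_equal. lia.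
Qed.

(** A bound on polynomials suffices: the images of the truncations of [f] converge coordinatewise to
    [ip (Bn n u) f], and [fatou] carries the bound over. Symmetry is likewise checked on truncations
    first. *)
Lemma hankel_op_exists (u : L2) (M : R) :
  (forall a N, ns (lsum (fun k => (a k)^*%C * Bn k u)%L2 N) <= M * psum a N) ->
  exists H, hankel_op H /\ forall f n, H f n = ip (Bn n u) f.
Proof.
  intro hM.
  (* The bound for the constant polynomial 1 reads [ns u <= M]. *)
  assert (hM0 : 0 <= M).
  { assert (h := hM (fun _ => RtoC 1) 1%nat). simpl in h.
    assert (h1 := ns_ge0 (l2zero + (RtoC 1)^*%C * u)%L2). unfold Cnorm2 in h. simpl in h.
    change (Bn 0 u) with u in h. lra. }
  assert (hex : forall f : L2, exists g : L2, (forall n, g n = ip (Bn n u) f) /\ ns g <= M * ns f).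
  { intro f.
    destruct (fatou (lsum (fun k => (f k)^*%C * Bn k u)%L2) (fun n => ip (Bn n u) f) (M * ns f))
      as [g [hg hb]].
    - intro n. apply Clim_ext with (fun N => ip (Bn n u) (trunc f N)).
      + intro N. now rewrite lsum_hankel.
      + apply tends_ip_r, tends_trunc.
    - intro N. eapply Rle_trans; [apply hM|]. apply Rmult_le_compat_l; [exact hM0|apply psum_le].
    - exists g. split; [intro n; now rewrite hg|exact hb]. }
  apply choice in hex. destruct hex as [H hH]. exists H.
  assert (hc : forall f n, H f n = ip (Bn n u) f) by (intros f n; apply hH).
  assert (hadd : forall f g, H (f + g)%L2 = (H f + H g)%L2).
  { intros f g. apply L2_eq. intro n. simpl. rewrite !hc. apply ip_addr. }
  assert (hscal : forall a f, H (a * f)%L2 = (a^*%C * H f)%L2).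
  { intros a f. apply L2_eq. intro n. simpl. rewrite !hc. apply ip_scalr. }
  split; [|exact hc]. constructor; auto.
  - intros f g.
    assert (ht : forall N, ip (H f) (trunc g N) = ip (H (trunc g N)) f).
    { intro N. unfold trunc. induction N as [|N IH]; simpl.
      - replace (H l2zero) with l2zero; [now rewrite ip_zerol, ip_zeror|].
        apply L2_eq. intro n. rewrite hc, ip_zeror. reflexivity.
      - rewrite ip_addr, hadd, ip_addl, IH, ip_scalr, hscal, ip_scall, ip_en, hc.
        replace (H (en N)) with (Bn N u); [reflexivity|].
        apply L2_eq. intro n. rewrite hc, ip_en, !co_Bn. f_equal. lia. }
    apply Clim_unique with (fun N => ip (H f) (trunc g N)).
    + apply tends_ip_r, tends_trunc.
    + apply Clim_ext with (fun N => ip (H (trunc g N)) f); [intro; now rewrite ht|].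
      apply tends_ip. apply tends_map with (2 := tends_trunc g) (M := M). intros a b.
      replace (H a - H b)%L2 with (H (a - b)%L2); [apply hH|].
      rewrite hadd, hscal. f_equal. l2ext.
  - intro f. apply L2_eq. intro n. simpl. rewrite !hc, ip_S_r. f_equal.
  - exists M. apply hH.
Qed.

(** * Quotients of sequences with the same autocorrelation *)

(* The pairs [(a p, a q)] with [a] a polynomial. *)
Inductive pact (p q : L2) : L2 -> L2 -> Prop :=
| pact0 : pact p q p q
| pact_add x y x' y' : pact p q x y -> pact p q x' y' -> pact p q (x + x')%L2 (y + y')%L2
| pact_scal a x y : pact p q x y -> pact p q (a * x)%L2 (a * y)%L2
| pact_S x y : pact p q x y -> pact p q (l2S x) (l2S y).

Lemma pact_Sn p q x y n : pact p q x y -> pact p q (Sn n x) (Sn n y).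
Proof. intro h. induction n; simpl; [exact h|]. now apply pact_S. Qed.

Lemma pact_cprod (p q theta : L2) x y :
  (forall n, q n = cprod p theta n) -> pact p q x y -> forall n, y n = cprod x theta n.
Proof.
  intros hq h. induction h as [|x y x' y' _ IH _ IH'|a x y _ IH|x y _ IH]; intro n;
    rewrite cprod_comm; simpl; try rewrite IH; try rewrite IH'.
  - rewrite hq. now rewrite cprod_comm.
  - rewrite cprod_plus_r. now rewrite (cprod_comm x), (cprod_comm x').
  - rewrite cprod_scal_r. now rewrite (cprod_comm x).
  - change (fun n0 => shseq x n0) with (shseq x). rewrite cprod_shseq_r, cprod_comm.
    destruct n; simpl; auto.
Qed.

Lemma Sn_S n x : Sn n (l2S x) = Sn (S n) x.
Proof. induction n as [|n IH]; [reflexivity|]. simpl. simpl in IH. now rewrite <- IH. Qed.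

(** On the circle, [x conj(x')] and [y conj(y')] have the same Fourier coefficients; the two clauses
    are the two signs of the frequency. *)
Definition same_corr (x y x' y' : L2) : Prop :=
  forall n, ip (Sn n x) x' = ip (Sn n y) y' /\ ip x (Sn n x') = ip y (Sn n y').

Lemma same_corr_sym x y x' y' : same_corr x y x' y' -> same_corr x' y' x y.
Proof.
  intros h n. destruct (h n) as [h1 h2]. split.
  - now rewrite ip_conj, h2, <- ip_conj.
  - now rewrite ip_conj, h1, <- ip_conj.
Qed.

Lemma Sn_add n x y : Sn n (x + y)%L2 = (Sn n x + Sn n y)%L2.
Proof.
  induction n as [|n IH]; [reflexivity|]. simpl. fold (Sn n (x + y)%L2). rewrite IH.
  apply L2_eq; intros [|k]; simpl; [cring|reflexivity].
Qed.

Lemma Sn_scal n a x : Sn n (a * x)%L2 = (a * Sn n x)%L2.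
Proof.
  induction n as [|n IH]; [reflexivity|]. simpl. fold (Sn n (a * x)%L2). rewrite IH.
  apply L2_eq; intros [|k]; simpl; [cring|reflexivity].
Qed.

Lemma pact_corr_step p q x' y' : same_corr p q x' y' ->
  forall x y, pact p q x y -> same_corr x y x' y'.
Proof.
  intros h0 x y h. induction h as [|x y x1 y1 _ IH _ IH'|a x y _ IH|x y _ IH]; [exact h0| | |].
  - intro n. destruct (IH n), (IH' n). rewrite !Sn_add, !ip_addl. split; congruence.
  - intro n. destruct (IH n). rewrite !Sn_scal, !ip_scall. split; congruence.
  - intro n. rewrite !Sn_S. split; [apply IH|].
    (* Multiplying [x] by [z] moves the frequency by one: at [n = 0] this crosses over to the other
       clause, and for larger [n] one shift cancels on both sides. *)
    destruct n as [|n]; [apply (IH 1%nat)|].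
    simpl. rewrite !ip_SS. apply IH.
Qed.

Lemma pact_corr p q : (forall n, ip q (Sn n q) = ip p (Sn n p)) ->
  forall x y x' y', pact p q x y -> pact p q x' y' -> same_corr x y x' y'.
Proof.
  intros h x y x' y' h1 h2. revert x y h1. apply pact_corr_step. apply same_corr_sym.
  revert x' y' h2. apply pact_corr_step. intro n. split; [|now rewrite h].
  now rewrite ip_conj, (ip_conj _ q), h.
Qed.

Lemma pact_low (p q : L2) m : (forall j, (j < m)%nat -> p j = RtoC 0) ->
  forall x y, pact p q x y -> forall j, (j < m)%nat -> x j = RtoC 0.
Proof.
  intros h0 x y h. induction h as [|x y x1 y1 _ IH _ IH'|a x y _ IH|x y _ IH]; intros j hj; simpl.
  - now apply h0.
  - rewrite IH, IH' by auto. cring.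
  - rewrite IH by auto. cring.
  - destruct j; simpl; [reflexivity|]. apply IH. lia.
Qed.

Lemma Clim_cprod (p : nat -> C) (F : nat -> nat -> C) (f : nat -> C) :
  (forall n, Clim (fun k => F k n) (f n)) ->
  forall n, Clim (fun k => cprod p (F k) n) (cprod p f n).
Proof.
  intros h n. revert F f h. induction n as [|n IH]; intros F f h.
  - rewrite cprod_0. apply Clim_ext with (fun k => p O * F k O)%C;
      [intro k; now rewrite cprod_0|]. now apply Clim_scal.
  - rewrite cprod_S.
    apply Clim_ext with (fun k => p (S n) * F k O + cprod p (fun j => F k (S j)) n)%C;
      [intro k; now rewrite cprod_S|].
    apply Clim_plus; [now apply Clim_scal|]. apply (IH (fun k j => F k (S j)) (fun j => f (S j))).
    intro j. apply h.
Qed.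

Lemma cprod_en (p : L2) k n : cprod p (en k) n = Sn k p n.
Proof.
  revert n. induction k as [|k IH]; intro n; [apply cprod_e0_r|].
  unfold en. simpl. change (fun n0 => shseq (Sn k e0) n0) with (shseq (Sn k e0)).
  rewrite cprod_shseq_r. destruct n; simpl; [reflexivity|apply IH].
Qed.

Lemma lsum_cprod (d : L2) (a : nat -> C) N n :
  lsum (fun k => a k * Sn k d)%L2 N n = cprod d (trunc a N) n.
Proof.
  unfold trunc. induction N as [|N IH]; simpl.
  - change (fun _ : nat => RtoC 0) with (co l2zero). symmetry.
    rewrite <- (l2_zero_scal l2zero). simpl. rewrite cprod_scal_r. cring.
  - rewrite IH. rewrite cprod_plus_r, cprod_scal_r, cprod_en. reflexivity.
Qed.

Lemma orth_shifts (d : L2) (c : R) :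
  ns d = c -> (forall n, ip d (Sn (S n) d) = RtoC 0) ->
  forall i j, ip (Sn i d) (Sn j d) = if Nat.eq_dec i j then RtoC c else RtoC 0.
Proof.
  intros hc h. induction i as [|i IH]; intros [|j]; simpl.
  - rewrite <- hc. apply ip_self.
  - apply (h j).
  - rewrite ip_conj. fold (Sn (S i) d). change (l2S (Sn i d)) with (Sn (S i) d).
    rewrite h. cring.
  - rewrite ip_SS. fold (Sn i d) (Sn j d). rewrite IH.
    destruct (Nat.eq_dec i j), (Nat.eq_dec (S i) (S j)); auto; lia.
Qed.

Lemma tends_Sn n F f : tends F f -> tends (fun k => Sn n (F k)) (Sn n f).
Proof. intro h. induction n; simpl; [exact h|]. now apply (tends_S (fun k => Sn n (F k))). Qed.

(* The minimiser [d] of the norm over the products [a p], [a] a polynomial with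
   [a(0) = 1], has orthogonal shifts, so [|d theta| <= |d| |theta|]; equality of the
   autocorrelations gives [|a theta p| = |a p|], hence [|d theta| = |d|]. *)
Lemma autocorr_quotient (p q theta : L2) :
  (exists m, p m <> RtoC 0) -> (forall n, q n = cprod p theta n) ->
  (forall n, ip q (Sn n q) = ip p (Sn n p)) -> 1 <= ns theta.
Proof.
  intros hp hq hcor.
  (* The first entry ranges over the products of [p] with polynomials of constant term 1; the second
     carries along the product of [q] with the same polynomial. *)
  set (A2 := fun a y => pact p q a y /\ exists w z, pact p q w z /\ a = (p + l2S w)%L2).
  destruct (min_norm (fun a => exists y, A2 a y)) as [F [d [hF [hFd hmin]]]].
  (* The polynomial 1, with the zero vector written as a multiple of [p] because [pact] has no
     constructor for it. *)
  { exists (p + l2S (RtoC 0 * p))%L2, (q + l2S (RtoC 0 * q))%L2. split.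
    - apply pact_add; [apply pact0|]. apply pact_S, pact_scal, pact0.
    - exists (RtoC 0 * p)%L2, (RtoC 0 * q)%L2. split; [apply pact_scal, pact0|reflexivity]. }
  { intros a b [y [h1 [w [z [h2 ->]]]]] [y' [h1' [w' [z' [h2' ->]]]]].
    exists (RtoC (1/2) * (y + y'))%L2. split; [now apply pact_scal, pact_add|].
    exists (RtoC (1/2) * (w + w'))%L2, (RtoC (1/2) * (z + z'))%L2.
    split; [now apply pact_scal, pact_add|].
    apply L2_eq; intros [|n]; simpl; apply injective_projections; simpl; field. }
  apply choice in hF. destruct hF as [Y hY].
  destruct (complete Y) as [y hy].
  (* Equal autocorrelations give [F i - F j] and [Y i - Y j] the same norm. *)
  { intros e he. destruct (tends_cauchy F d hFd e he) as [N hN]. exists N. intros i j hi hj.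
    specialize (hN i j hi hj).
    assert (hp' : pact p q (F i - F j)%L2 (Y i - Y j)%L2).
    { apply pact_add; [apply hY|]. apply pact_scal, hY. }
    destruct (pact_corr p q hcor _ _ _ _ hp' hp' 0%nat) as [_ h].
    simpl in h. unfold ns in *. rewrite <- h. exact hN. }
  assert (hyc : forall n, y n = cprod d theta n).
  { intro n. apply Clim_unique with (fun k => Y k n); [now apply tends_co|].
    apply Clim_ext with (fun k => cprod theta (F k) n).
    - intro k. rewrite (pact_cprod p q theta _ _ hq (proj1 (hY k)) n). now rewrite cprod_comm.
    - rewrite cprod_comm. apply Clim_cprod. intro j. now apply tends_co. }
  assert (hyn : ns y = ns d).
  { apply Rlim_unique with (fun k => ns (Y k)); [now apply tends_ns|].
    apply is_lim_seq_ext with (fun k => ns (F k)); [|now apply tends_ns].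
    intro k. destruct (pact_corr p q hcor _ _ _ _ (proj1 (hY k)) (proj1 (hY k)) 0%nat) as [_ h].
    simpl in h. unfold ns. now rewrite h. }
  (* The constant term 1 keeps the lowest coefficient of [p] unchanged along the minimising
     sequence, so it survives in [d]. *)
  assert (hd0 : 0 < ns d).
  { apply least in hp. destruct hp as [m [hm hj]].
    assert (hdm : d m = p m).
    { apply Clim_unique with (fun k => F k m); [now apply tends_co|].
      apply Clim_ext with (fun _ => p m); [|apply Clim_const].
      intro k. destruct (hY k) as [_ [w [z [hw ->]]]]. simpl.
      destruct m as [|m]; simpl; [cring|].
      rewrite (pact_low p q (S m)) with (x := w) (y := z); auto; [cring|].
      intros j hjm. apply NNPP. now apply hj. }
    destruct (Rle_lt_or_eq_dec 0 (ns d) (ns_ge0 d)) as [h|h]; [exact h|].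
    exfalso. apply hm. rewrite <- hdm. rewrite (ns_eq0 d); auto. }
  (* Adding [c z^(n+1) F k] to [F k] preserves the constant term 1 of the polynomial, so the sum
     still competes in the minimisation. *)
  assert (hort : forall n, ip d (Sn (S n) d) = RtoC 0).
  { intro n. apply min_orth. intro c.
    apply (is_lim_seq_le (fun _ => ns d) (fun k => ns (F k + c * Sn (S n) (F k))%L2)
            (ns d) (ns (d + c * Sn (S n) d)%L2)).
    - intro k. apply hmin. destruct (hY k) as [h1 [w [z [h2 h3]]]].
      exists (Y k + c * Sn (S n) (Y k))%L2. split.
      + apply pact_add; [exact h1|]. now apply pact_scal, pact_Sn.
      + exists (w + c * Sn n (F k))%L2, (z + c * Sn n (Y k))%L2. split.
        * apply pact_add; [exact h2|]. now apply pact_scal, pact_Sn.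
        * rewrite h3 at 1. apply L2_eq; intros [|j]; simpl; cring.
    - apply is_lim_seq_const.
    - apply tends_ns. apply tends_add; [exact hFd|]. apply tends_scal. now apply tends_Sn. }
  (* The product [d theta] is the sum of the orthogonal vectors [theta_k z^k d], so its squared norm
     is at most [ns d * ns theta]. *)
  destruct (fatou (lsum (fun k => theta k * Sn k d)%L2) (cprod d theta) (ns d * ns theta))
    as [g [hg hgn]].
  { intro n. apply Clim_ext with (fun N => cprod d (trunc theta N) n).
    - intro N. now rewrite lsum_cprod.
    - apply Clim_cprod. intro j. apply tends_co, tends_trunc. }
  { intro N. rewrite (ns_lsum_orth (fun k => Sn k d) (ns d)).
    - apply Rmult_le_compat_l; [lra|apply psum_le].
    - intros i j _ _. now apply orth_shifts. }
  replace g with y in hgn by (apply L2_eq; intro n; rewrite hyc, hg; reflexivity).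
  rewrite hyn in hgn. apply Rmult_le_reg_l with (ns d); lra.
Qed.

(** * The fixed space of the square of a Hankel operator *)

Definition fixH (H : L2 -> L2) (f : L2) : Prop := H (H f) = f.

Lemma fixH_add H f g : hankel_op H -> fixH H f -> fixH H g -> fixH H (f + g)%L2.
Proof. intros hH hf hg. unfold fixH in *. rewrite !(ho_add H hH). congruence. Qed.

Lemma fixH_scal H a f : hankel_op H -> fixH H f -> fixH H (a * f)%L2.
Proof.
  intros hH hf. unfold fixH in *. rewrite !(ho_scal H hH), hf. now rewrite Cconj_conj.
Qed.

Lemma fixH_H H f : fixH H f -> fixH H (H f).
Proof. unfold fixH. congruence. Qed.

Lemma fixH_lim H F f : hankel_op H -> (forall k, fixH H (F k)) -> tends F f -> fixH H f.
Proof.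
  intros hH hF ht. apply (tends_unique F); [|exact ht].
  assert (h := tends_ho H _ _ hH (tends_ho H _ _ hH ht)).
  unfold tends in *. eapply is_lim_seq_ext; [|exact h]. intro k. simpl. now rewrite hF.
Qed.

Lemma Sn_B_split (f : L2) : f = (f O * e0 + l2S (l2B f))%L2.
Proof. apply L2_eq; intros [|n]; simpl; cring. Qed.

Lemma l2S_B (f : L2) : f O = RtoC 0 -> l2S (l2B f) = f.
Proof. intro h. apply L2_eq; intros [|n]; simpl; auto. Qed.

Lemma H_apply_0 H f : hankel_op H -> (H f) O = ip (H e0) f.
Proof. intro hH. now rewrite <- ip_e0, (ho_sym H hH). Qed.

(* The rank-one relation between the squares of [H] and of [l2B \o H]. *)
Lemma HH_shift H f : hankel_op H ->
  l2B (H (H (l2S f))) = (H (H f) - ((H f O)^*)%C * H e0)%L2.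
Proof.
  intro hH. rewrite <- (ho_shift H hH), (ho_shift H hH f).
  rewrite (Sn_B_split (H f)) at 2.
  rewrite (ho_add H hH), (ho_scal H hH). l2ext.
Qed.

(** With both [f] and [l2S f] fixed, the rank-one term in [HH_shift] must vanish; pairing it with
    [f] yields the squared modulus of [H f O]. *)
Lemma fixH_shift_0 H f : hankel_op H -> fixH H f -> fixH H (l2S f) -> H f O = RtoC 0.
Proof.
  intros hH hf hSf. assert (h := HH_shift H f hH).
  rewrite hf, hSf, l2B_S in h.
  assert (h1 : ip (((H f O)^*)%C * H e0)%L2 f = RtoC 0).
  { replace (((H f O)^*)%C * H e0)%L2 with (f - (f - ((H f O)^*)%C * H e0))%L2 by l2ext.
    rewrite <- h. replace (f - f)%L2 with l2zero by l2ext. apply ip_zerol. }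
  rewrite ip_scall, <- H_apply_0, Cconj_mul_self in h1 by exact hH.
  apply Cnorm2_eq0. now apply (f_equal fst) in h1.
Qed.

Definition vanishing_order (E : L2 -> Prop) (m : nat) : Prop :=
  (exists f, E f /\ f m <> RtoC 0) /\ forall f j, E f -> (j < m)%nat -> f j = RtoC 0.

(** For positive order, [H (l2S f) = l2B (H f)] is again in the fixed space, so its coefficient just
    below the order vanishes; that coefficient is [H f m]. *)
Lemma fixH_shift_m H m f : hankel_op H -> vanishing_order (fixH H) m ->
  fixH H f -> fixH H (l2S f) -> H f m = RtoC 0.
Proof.
  intros hH [_ hm] hf hSf. destruct m as [|m]; [now apply fixH_shift_0|].
  apply fixH_H in hSf. rewrite (ho_shift H hH) in hSf.
  apply (hm _ m hSf). lia.
Qed.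

Lemma HH_back H f : hankel_op H -> fixH H f -> f O = RtoC 0 ->
  H (H (l2B f)) = (l2B f + ((H (l2B f) O)^*)%C * H e0)%L2.
Proof.
  intros hH hf h0. assert (h := HH_shift H (l2B f) hH).
  rewrite (l2S_B f h0), hf in h. set (x := H (H (l2B f))) in *.
  set (c := ((H (l2B f) O)^*)%C) in *. clearbody x c. rewrite h. l2ext.
Qed.

Lemma fixH_back_criterion H f : hankel_op H -> fixH H f -> f O = RtoC 0 ->
  H (l2B f) O = RtoC 0 -> fixH H (l2B f).
Proof.
  intros hH hf h0 hz. unfold fixH. rewrite HH_back by assumption. rewrite hz. l2ext.
Qed.

(** Near invariance. By [fixH_back_criterion] the only obstruction is the scalar [H (l2B f) O], and
    a vector [f1] with nonzero coefficient [m] excludes it, by different arguments for [m = 0] and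
    [m > 0]. *)
Lemma fixH_back H m f : hankel_op H -> vanishing_order (fixH H) m ->
  fixH H f -> f m = RtoC 0 -> fixH H (l2B f).
Proof.
  intros hH [[f1 [hf1 hf1m]] hm] hf hfm.
  assert (h0 : forall g, fixH H g -> g m = RtoC 0 -> g O = RtoC 0).
  { intros g hg hgm. destruct m as [|m]; [exact hgm|]. apply hm; [exact hg|lia]. }
  apply fixH_back_criterion; auto.
  destruct m as [|m].
  (* Pairing with [H f1] works because the square of [H] is self-adjoint and fixes [H f1], while
     [ip (H e0) (H f1)] equals [f1 O], which is nonzero. *)
  - assert (h := HH_back H f hH hf (h0 f hf hfm)).
    apply (f_equal (fun x => ip x (H f1))) in h.
    rewrite ip_addl, ip_scall, <- (H_apply_0 H (H f1) hH), hf1 in h.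
    assert (h2 : ip (H (H (l2B f))) (H f1) = ip (l2B f) (H f1)).
    { rewrite (ho_sym H hH), hf1, ip_conj, (ho_sym H hH), <- ip_conj. reflexivity. }
    rewrite h2 in h.
    assert (h3 : (f1 O * (H (l2B f) O)^*)%C = RtoC 0).
    { replace (f1 O * (H (l2B f) O)^*)%C with
        (ip (l2B f) (H f1) + (H (l2B f) O)^* * f1 O + RtoC (-1) * ip (l2B f) (H f1))%C by cring.
      rewrite <- h. cring. }
    apply Cmul_eq0 in h3; [|exact hf1m].
    rewrite <- (Cconj_conj (H (l2B f) O)), h3. cring.
  - apply NNPP. intro hz.
    (* If [a] were nonzero, subtracting a multiple of [f] would remove the obstruction for [f1], and
       the backward shift of the difference would be a fixed vector of too low an order. The
       conjugate in [c] compensates antilinearity. *)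
    set (a := H (l2B f) O) in *. set (b := H (l2B f1) O).
    set (c := ((b / a)^*)%C).
    assert (hg : fixH H (f1 - c * f)%L2) by (apply fixH_add; auto; apply fixH_scal, fixH_scal; auto).
    assert (hg0 : (f1 - c * f)%L2 O = RtoC 0) by (apply (hm _ _ hg); lia).
    assert (hB : fixH H (l2B (f1 - c * f)%L2)).
    { apply fixH_back_criterion; auto.
      replace (l2B (f1 - c * f)%L2) with (l2B f1 - c * l2B f)%L2 by l2ext.
      rewrite (ho_add H hH), !(ho_scal H hH). simpl. fold a b. unfold c.
      rewrite Cconj_conj.
      replace (Cplus b (Cmult (Defs.Cconj (RtoC (-1))) (Cmult (Cdiv b a) a))) with
        (b + - (b / a * a))%C by cring.
      field. exact hz. }
    assert (h1 := hm _ m hB (Nat.lt_succ_diag_r m)). simpl in h1. rewrite hfm in h1.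
    apply hf1m. rewrite <- h1. cring.
Qed.

(** [p] is the normalised vector of least norm among the fixed vectors with coefficient 1 at [m],
    hence a multiple of the Riesz representative of [g |-> g m]; [k] is the norm of that
    minimiser. *)
Lemma fixH_extremal H m : hankel_op H -> vanishing_order (fixH H) m ->
  exists (p : L2) (k : R), fixH H p /\ ns p = 1 /\ 0 < k /\
    forall g, fixH H g -> ip g p = (RtoC k * g m)%C.
Proof.
  intros hH [[f1 [hf1 hf1m]] _].
  destruct (min_norm (fun f => fixH H f /\ f m = RtoC 1)) as [F [d [hF [hFd hmin]]]].
  { exists ((/ f1 m)%C * f1)%L2. split; [now apply fixH_scal|].
    simpl. change (Cmult (Cinv (f1 m)) (f1 m) = RtoC 1). field. exact hf1m. }
  { intros a b [h1 h2] [h3 h4]. split; [now apply fixH_scal, fixH_add|].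
    simpl. rewrite h2, h4. apply injective_projections; simpl; lra. }
  assert (hd : fixH H d) by (apply (fixH_lim H F); auto; intro k; apply hF).
  assert (hdm : d m = RtoC 1).
  { apply Clim_unique with (fun k => F k m); [now apply tends_co|].
    apply Clim_ext with (fun _ => RtoC 1); [|apply Clim_const]. intro k. symmetry. apply hF. }
  assert (hort : forall g, fixH H g -> g m = RtoC 0 -> ip d g = RtoC 0).
  { intros g hg hgm. apply min_orth. intro c. apply hmin. split.
    - apply fixH_add; auto. now apply fixH_scal.
    - simpl. rewrite hdm, hgm. cring. }
  assert (hd0 : 0 < ns d).
  { eapply Rlt_le_trans; [|apply (co_le_ns d m)]. rewrite hdm. unfold Cnorm2; simpl. lra. }
  assert (hs : 0 < sqrt (ns d)) by now apply sqrt_lt_R0.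
  assert (hss : sqrt (ns d) * sqrt (ns d) = ns d) by (apply sqrt_sqrt; lra).
  set (r := sqrt (ns d)) in *. clearbody r.
  exists (RtoC (/ r) * d)%L2, r. split; [now apply fixH_scal|].
  split; [|split; [exact hs|]].
  - rewrite ns_scal. unfold Cnorm2; simpl. rewrite <- hss. field. lra.
  - intros g hg.
    assert (h : ip d (g - g m * d)%L2 = RtoC 0).
    { apply hort; [apply fixH_add; auto; now apply fixH_scal, fixH_scal|].
      simpl. rewrite hdm. cring. }
    rewrite ip_addr, !ip_scalr, ip_self in h.
    assert (h2 : ip g d = (g m * RtoC (ns d))%C).
    { rewrite (ip_conj g d).
      replace (ip d g) with (ip d g + (RtoC (-1))^* * ((g m)^* * RtoC (ns d)) + (g m)^* * RtoC (ns d))%C by cring.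
      rewrite h. cring. }
    rewrite ip_scalr, h2. rewrite <- hss.
    apply injective_projections; simpl; field; lra.
Qed.

(** * Iterating the nearly invariant shift *)

(** All that the construction of [theta] uses about [p]: the order [m] disappears, a zero of the
    coefficient [m] being expressed as orthogonality to [p]. *)
Record near_inv (H : L2 -> L2) (p : L2) : Prop := {
  ni_H : hankel_op H;
  ni_p : fixH H p;
  ni_ns : ns p = 1;
  ni_back : forall g, fixH H g -> ip g p = RtoC 0 -> fixH H (l2B g) /\ l2S (l2B g) = g;
  ni_shift : forall f, fixH H f -> fixH H (l2S f) -> ip (H f) p = RtoC 0 }.

Lemma near_inv_exists H : hankel_op H -> (exists f, fixH H f /\ exists n, f n <> RtoC 0) ->
  exists p, near_inv H p.
Proof.
  intros hH [f [hf hn]].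
  destruct (least (fun n => exists f, fixH H f /\ f n <> RtoC 0)) as [m [hm hj]].
  { destruct hn as [n hn]. now exists n, f. }
  assert (hv : vanishing_order (fixH H) m).
  { split; [exact hm|]. intros g j hg hjm. apply NNPP. intro h. apply (hj j hjm). now exists g. }
  destruct (fixH_extremal H m hH hv) as [p [k [hp [hpn [hk hip]]]]].
  exists p. constructor; auto.
  - intros g hg h0.
    assert (hgm : g m = RtoC 0).
    { rewrite hip in h0 by exact hg. apply Cmul_eq0 in h0; auto.
      intro h. apply (f_equal fst) in h. simpl in h. lra. }
    split; [now apply (fixH_back H m)|]. apply l2S_B.
    destruct m as [|m]; [exact hgm|]. apply hv; [exact hg|lia].
  - intros g hg hSg. rewrite hip by now apply fixH_H.
    rewrite (fixH_shift_m H m) by assumption. cring.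
Qed.

(* Hitt's division step; the coefficients [Cf] are those of the quotient by [p]. *)
Definition Rp (p g : L2) : L2 := l2B (g - ip g p * p)%L2.
Definition Rn (p : L2) (k : nat) : L2 -> L2 := Nat.iter k (Rp p).
Definition Cf (p g : L2) (k : nat) : C := ip (Rn p k g) p.

Lemma Rn_S p k g : Rn p k (Rp p g) = Rn p (S k) g.
Proof. unfold Rn. now rewrite Nat.iter_succ_r. Qed.

Lemma Rn_add p j k g : Rn p j (Rn p k g) = Rn p (j + k) g.
Proof. unfold Rn. now rewrite Nat.iter_add. Qed.

Lemma Rp_add p f g : Rp p (f + g)%L2 = (Rp p f + Rp p g)%L2.
Proof. unfold Rp. rewrite ip_addl. l2ext. Qed.

Lemma Rp_scal p a g : Rp p (a * g)%L2 = (a * Rp p g)%L2.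
Proof. unfold Rp. rewrite ip_scall. l2ext. Qed.

Lemma Rn_lin p k f g : Rn p k (f + g)%L2 = (Rn p k f + Rn p k g)%L2.
Proof. induction k as [|k IH]; simpl; [reflexivity|]. fold (Rn p k). rewrite IH. apply Rp_add. Qed.

Lemma Rn_scal p k a g : Rn p k (a * g)%L2 = (a * Rn p k g)%L2.
Proof. induction k as [|k IH]; simpl; [reflexivity|]. fold (Rn p k). rewrite IH. apply Rp_scal. Qed.

Lemma Cf_S p g k : Cf p (Rp p g) k = Cf p g (S k).
Proof. unfold Cf. now rewrite Rn_S. Qed.

Lemma ni_minus H p g : near_inv H p -> fixH H g ->
  fixH H (g - ip g p * p)%L2 /\ ip (g - ip g p * p)%L2 p = RtoC 0.
Proof.
  intros hn hg. split.
  - apply fixH_add; [apply hn|exact hg|]. apply fixH_scal; [apply hn|].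
    apply fixH_scal; apply hn.
  - rewrite ip_addl, !ip_scall, ip_self, (ni_ns _ _ hn). cring.
Qed.

Lemma fixH_Rp H p g : near_inv H p -> fixH H g -> fixH H (Rp p g).
Proof. intros hn hg. destruct (ni_minus H p g hn hg) as [h1 h2]. now apply (ni_back H p hn). Qed.

Lemma S_Rp H p g : near_inv H p -> fixH H g -> l2S (Rp p g) = (g - ip g p * p)%L2.
Proof. intros hn hg. destruct (ni_minus H p g hn hg) as [h1 h2]. now apply (ni_back H p hn). Qed.

Lemma fixH_Rn H p k g : near_inv H p -> fixH H g -> fixH H (Rn p k g).
Proof. intros hn hg. induction k as [|k IH]; [exact hg|]. now apply fixH_Rp. Qed.

Lemma cprod_Cf H p g : near_inv H p -> fixH H g -> forall n, g n = cprod p (Cf p g) n.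
Proof.
  intros hn hg n. revert g hg. induction n as [|n IH]; intros g hg.
  - assert (h := f_equal (fun x : L2 => x O) (S_Rp H p g hn hg)). simpl in h.
    rewrite cprod_0. unfold Cf. simpl.
    replace (g O) with (g O + RtoC (-1) * (ip g p * p O) + ip g p * p O)%C by cring.
    rewrite <- h. cring.
  - rewrite cprod_S.
    replace (fun k => Cf p g (S k)) with (Cf p (Rp p g))
      by (apply functional_extensionality; intro; apply Cf_S).
    rewrite <- IH by now apply fixH_Rp. unfold Cf. cring.
Qed.

Lemma ip_Rp H p f g : near_inv H p -> fixH H f -> fixH H g ->
  ip f g = (ip f p * (ip g p)^* + ip (Rp p f) (Rp p g))%C.
Proof.
  intros hn hf hg.
  rewrite <- (ip_SS (Rp p f)), (S_Rp H p f hn hf), (S_Rp H p g hn hg).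
  rewrite !ip_addl, !ip_addr, !ip_scall, !ip_scalr, ip_self, (ni_ns _ _ hn), (ip_conj p g).
  cring.
Qed.

(** Iterates the orthogonal splitting [ip_Rp]. [G] is a bundled copy of [Cf p g], needed because
    [ip] takes elements of [L2]; the last term is the remainder to be controlled. *)
Lemma ip_parseval H p f g (G : L2) N : near_inv H p -> fixH H f -> fixH H g -> co G = Cf p g ->
  ip f g = (ip (trunc (Cf p f) N) G + ip (Rn p N f) (Rn p N g))%C.
Proof.
  intros hn hf hg hG. unfold trunc. induction N as [|N IH]; simpl.
  - rewrite ip_zerol. cring.
  - rewrite IH, ip_addl, ip_scall, (ip_conj (en N)), ip_en, hG.
    rewrite (ip_Rp H p (Rn p N f) (Rn p N g)) by (auto; now apply fixH_Rn).
    unfold Cf. cring.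
Qed.

Lemma ns_Rp H p g : near_inv H p -> fixH H g -> ns g = Cnorm2 (ip g p) + ns (Rp p g).
Proof.
  intros hn hg. unfold ns. rewrite (ip_Rp H p g g hn hg hg) at 1. unfold Cnorm2. simpl. ring.
Qed.

Lemma ns_Rn H p N g : near_inv H p -> fixH H g -> ns g = psum (Cf p g) N + ns (Rn p N g).
Proof.
  intros hn hg. induction N as [|N IH]; simpl; [ring|].
  rewrite IH, (ns_Rp H p (Rn p N g)) by (auto; now apply fixH_Rn). unfold Cf.
  change (Nat.iter N (Rp p) g) with (Rn p N g). ring.
Qed.

(** Only the component of [f] along [p] sees [l2S (H p)]: the rest of [f] is [l2S (Rp p f)], and its
    pairing is the conjugate of [ip (H (Rp p f)) p], zero by [ni_shift]. *)
Lemma ip_shift_q H p f : near_inv H p -> fixH H f ->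
  ip f (l2S (H p)) = (ip f p * ip p (l2S (H p)))%C.
Proof.
  intros hn hf.
  assert (h := S_Rp H p f hn hf). assert (hH := ni_H H p hn).
  assert (h1 : ip (l2S (Rp p f)) (l2S (H p)) = RtoC 0).
  { rewrite ip_SS, ip_conj, (ho_sym H hH).
    rewrite (ni_shift H p hn); [cring|now apply fixH_Rp|].
    rewrite h. now apply (ni_minus H p f hn hf). }
  rewrite h, ip_addl, !ip_scall in h1.
  replace (ip f (l2S (H p))) with (ip f (l2S (H p)) + RtoC (-1) * (ip f p * ip p (l2S (H p)))
    + ip f p * ip p (l2S (H p)))%C by cring. rewrite h1. cring.
Qed.

(* The adjoint of [Rp p] on the fixed space is its conjugate by [H]. *)
Lemma adj_Rp H p f g : near_inv H p -> fixH H f -> fixH H g ->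
  ip (Rp p f) g = ip f (H (Rp p (H g))).
Proof.
  intros hn hf hg. assert (hH := ni_H H p hn).
  set (q := H p). assert (hq : H q = p) by apply hn.
  assert (hHg := fixH_H H g hg).
  assert (L : ip (Rp p f) g = (ip f (l2S g) + RtoC (-1) * (ip f p * ip p (l2S g)))%C).
  { rewrite <- (ip_SS (Rp p f)), (S_Rp H p f hn hf), ip_addl, !ip_scall. reflexivity. }
  assert (R1 : ip (H f) (H (l2S g)) = (ip f (l2S g))^*%C).
  { rewrite ip_conj, (ho_sym H hH), hf. reflexivity. }
  assert (R2 : ip (l2S (H f)) p = (ip f (l2S q))^*%C).
  { rewrite <- hq at 1. rewrite ip_S_l, <- (ho_shift H hH), ip_conj, (ho_sym H hH), hf. reflexivity. }
  assert (R3 : ip p (l2S g) = ip (H g) (l2S q)).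
  { rewrite <- hq at 1. rewrite ip_S_r, <- (ho_shift H hH). apply (ho_sym H hH). }
  (* Both sides become [<f, S g>] minus [<f, p> <H g, p> <p, S q>], by [ip_shift_q] applied to [f]
     and to [H g]. *)
  rewrite L, (ip_conj f (H (Rp p (H g)))), (ho_sym H hH).
  rewrite <- (ip_SS (H f)), (S_Rp H p (H g) hn hHg), ip_addr, !ip_scalr.
  replace (ip (l2S (H f)) (H g)) with (ip (H f) (H (l2S g)))
    by (now rewrite ip_S_l, <- (ho_shift H hH)).
  rewrite R1, R2, R3, (ip_shift_q H p f hn hf : ip f (l2S q) = _),
    (ip_shift_q H p (H g) hn hHg : ip (H g) (l2S q) = _). fold q. cring.
Qed.

Lemma adj_Rn H p k f g : near_inv H p -> fixH H f -> fixH H g ->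
  ip (Rn p k f) g = ip f (H (Rn p k (H g))).
Proof.
  intros hn hf. revert g. induction k as [|k IH]; intros g hg.
  - simpl. now rewrite hg.
  - simpl. fold (Rn p k f). rewrite (adj_Rp H p) by (auto; now apply fixH_Rn).
    assert (h := fixH_Rp H p (H g) hn (fixH_H H g hg)).
    rewrite IH by now apply fixH_H. rewrite h, Rn_S. reflexivity.
Qed.

(** The coefficients of the quotient of [H g] by [p] are thus inner products of [g] with the orbit
    of one vector, [H p]; this is the source of the Hankel structure of [theta]. *)
Lemma ip_Rn_q H p k g : near_inv H p -> fixH H g -> ip (Rn p k (H p)) g = Cf p (H g) k.
Proof.
  intros hn hg. assert (hH := ni_H H p hn).
  rewrite (adj_Rn H p) by (auto; apply fixH_H, hn).
  rewrite (ho_sym H hH).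
  rewrite (fixH_Rn H p k (H g) hn (fixH_H H g hg)). reflexivity.
Qed.

(** * Inner sequences *)

Definition inner2 (theta : L2) : Prop :=
  forall k, ip (Bn k theta) theta = match k with O => RtoC 1 | _ => RtoC 0 end.

Lemma lsum_ext (F G : nat -> L2) N : (forall k, (k < N)%nat -> F k = G k) -> lsum F N = lsum G N.
Proof.
  induction N as [|N IH]; intro h; simpl; [reflexivity|]. now rewrite IH, h by auto.
Qed.

Lemma Bn_lsum j (F : nat -> L2) N : Bn j (lsum F N) = lsum (fun k => Bn j (F k)) N.
Proof.
  induction N as [|N IH]; simpl.
  - apply L2_eq; intro n. rewrite co_Bn. reflexivity.
  - rewrite <- IH. apply L2_eq; intro n. simpl. now rewrite !co_Bn.
Qed.

Lemma Bn_Sn j k (x : L2) : Bn (k + j) (Sn j x) = Bn k x.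
Proof.
  revert k. induction j as [|j IH]; intro k; [now rewrite Nat.add_0_r|].
  rewrite <- Sn_S, Nat.add_succ_r. rewrite <- Bn_S, Sn_S. simpl. rewrite l2B_S. apply IH.
Qed.

Lemma Bn_scal k a (x : L2) : Bn k (a * x)%L2 = (a * Bn k x)%L2.
Proof. apply L2_eq; intro n. simpl. now rewrite !co_Bn. Qed.

Lemma ns_B (f : L2) : ns (l2B f) <= ns f.
Proof.
  rewrite (Sn_B_split f) at 2. rewrite ns_add, ns_scal, ns_S, ip_S_r.
  replace (l2B (f O * e0)%L2) with l2zero by (apply L2_eq; intro n; simpl; cring).
  rewrite ip_zerol. assert (h := Cnorm2_ge0 (f O)). assert (h1 := ns_ge0 e0).
  simpl. nra.
Qed.

Lemma ns_Bn k (f : L2) : ns (Bn k f) <= ns f.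
Proof.
  induction k as [|k IH]; simpl; [lra|]. eapply Rle_trans; [apply ns_B|exact IH].
Qed.

Lemma psum_conj a N : psum (fun k => (a k)^*%C) N = psum a N.
Proof. induction N as [|N IH]; simpl; [reflexivity|]. now rewrite IH, Cnorm2_conj. Qed.

(** The image of a polynomial is [Bn N] applied to a combination of the shifts [Sn (N - k) theta].
    These are orthonormal for inner [theta], and [Bn N] is a contraction, so the bound is 1. *)
Lemma inner_hankel theta : inner2 theta ->
  exists T, hankel_op T /\ forall f n, T f n = ip (Bn n theta) f.
Proof.
  intro hi. apply (hankel_op_exists theta 1). intros a N.
  rewrite (lsum_ext _ (fun k => Bn N ((a k)^*%C * Sn (N - k) theta)%L2)).
  - rewrite <- Bn_lsum. eapply Rle_trans; [apply ns_Bn|].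
    rewrite (ns_lsum_orth _ 1); [rewrite psum_conj; lra|].
    intros i j hi' hj'.
    rewrite (orth_shifts theta 1).
    + destruct (Nat.eq_dec (N - i) (N - j)), (Nat.eq_dec i j); auto; lia.
    + assert (h := hi O). simpl in h. unfold ns. now rewrite h.
    + intro n. rewrite ip_Sn_r. apply hi.
  - intros k hk. rewrite Bn_scal. f_equal.
    replace N with (k + (N - k))%nat at 1 by lia. now rewrite Bn_Sn.
Qed.

Lemma hankel_en theta (T : L2 -> L2) k : (forall f n, T f n = ip (Bn n theta) f) -> T (en k) = Bn k theta.
Proof.
  intro hT. apply L2_eq. intro n. rewrite hT, ip_en, !co_Bn. f_equal. lia.
Qed.

Lemma hankel_inner theta (T : L2 -> L2) : inner2 theta -> (forall f n, T f n = ip (Bn n theta) f) -> T theta = e0.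
Proof. intros hi hT. apply L2_eq. intro n. rewrite hT, hi. destruct n; reflexivity. Qed.

(** * Schmidt subspaces as multiples of model spaces *)

Lemma near_inv_model H p : near_inv H p ->
  exists theta T, inner2 theta /\ hankel_op T /\ (forall f n, T f n = ip (Bn n theta) f) /\
    (forall n, H p n = cprod p theta n) /\
    (forall h, exists F, fixH H F /\ (forall n, F n = cprod p (T h) n) /\ ns F = ns (T h)) /\
    (forall F, fixH H F -> exists h, forall n, F n = cprod p (T h) n).
Proof.
  intro hn. assert (hH := ni_H H p hn). assert (hp := ni_p H p hn).
  (* [CL] is to be a total function, so off the fixed space it takes [g] itself as a dummy value. *)
  assert (hCL : forall g, exists G : L2, fixH H g -> co G = Cf p g /\ ns G <= ns g).
  { intro g. destruct (classic (fixH H g)) as [hg|hg]; [|now exists g].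
    destruct (l2_of_psum (Cf p g) (ns g)) as [G hG].
    - intro N. rewrite (ns_Rn H p N g hn hg). assert (h := ns_ge0 (Rn p N g)). lra.
    - now exists G. }
  apply choice in hCL. destruct hCL as [CL hCL].
  assert (CLco : forall g, fixH H g -> co (CL g) = Cf p g) by (intros; now apply hCL).
  assert (CLadd : forall f g, fixH H f -> fixH H g -> CL (f + g)%L2 = (CL f + CL g)%L2).
  { intros f g hf hg. apply L2_eq. intro n. simpl.
    rewrite !CLco by (auto; now apply fixH_add). unfold Cf. now rewrite Rn_lin, ip_addl. }
  assert (CLscal : forall a f, fixH H f -> CL (a * f)%L2 = (a * CL f)%L2).
  { intros a f hf. apply L2_eq. intro n. simpl.
    rewrite !CLco by (auto; now apply fixH_scal). unfold Cf. now rewrite Rn_scal, ip_scall. }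
  set (q := H p). assert (hq : fixH H q) by now apply fixH_H.
  set (theta := CL q).
  assert (hpth : forall n, q n = cprod p theta n).
  { intro n. unfold theta. rewrite (CLco q hq). now apply (cprod_Cf H). }
  assert (hnq : ns q = 1).
  { rewrite <- (ni_ns H p hn). unfold ns, q. rewrite (ho_sym H hH). now rewrite hp. }
  assert (hp0 : exists m, p m <> RtoC 0).
  { apply NNPP. intro h. assert (hz : p = l2zero).
    { apply L2_eq. intro n. apply NNPP. intro h'. apply h. now exists n. }
    assert (h1 := ni_ns H p hn). rewrite hz in h1. unfold ns in h1. rewrite ip_zerol in h1.
    simpl in h1. lra. }
  (* The upper bound is contractivity of [CL]; for the lower bound, [H] intertwines the two shifts,
     so [q] and [p] have the same autocorrelation. *)
  assert (hnth : ns theta = 1).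
  { apply Rle_antisym.
    - rewrite <- hnq. unfold theta. now apply hCL.
    - apply (autocorr_quotient p q theta hp0 hpth). intro n.
      rewrite ip_Sn_r. unfold q.
      assert (hBn : forall k f, Bn k (H f) = H (Sn k f)).
      { induction k as [|k IH]; intro f; [reflexivity|].
        simpl. fold (Sn k f) (Bn k (H f)). rewrite IH. symmetry. apply (ho_shift H hH). }
      rewrite hBn, (ho_sym H hH), hp. reflexivity. }
  assert (hRq : is_lim_seq (fun N => ns (Rn p N q)) 0).
  { apply is_lim_seq_ext with (fun N => ns theta - psum theta N).
    - intro N. rewrite hnth, <- hnq, (ns_Rn H p N q hn hq). unfold theta. rewrite CLco by exact hq. ring.
    - replace (Finite 0) with (Finite (ns theta - ns theta)) by (f_equal; ring).
      apply is_lim_seq_minus'; [apply is_lim_seq_const|apply psum_lim]. }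
  assert (hRk : forall k, fixH H (Rn p k q)) by (intro; now apply fixH_Rn).
  assert (CLk : forall k, CL (Rn p k q) = Bn k theta).
  { intro k. apply L2_eq. intro n. rewrite co_Bn. unfold theta. rewrite !CLco by auto.
    unfold Cf. now rewrite Rn_add. }
  (* In [ip_parseval] the remainder tends to zero because its first factor does; the second only has
     to stay bounded by [ns g]. *)
  assert (key : forall k g, fixH H g -> ip (Rn p k q) g = ip (CL (Rn p k q)) (CL g)).
  { intros k g hg.
    apply Clim_unique with (fun _ : nat => ip (Rn p k q) g); [apply Clim_const|].
    apply Clim_ext with (fun N => ip (trunc (CL (Rn p k q)) N) (CL g)
                          + ip (Rn p N (Rn p k q)) (Rn p N g))%C.
    - intro N. rewrite (CLco _ (hRk k)). symmetry. now apply (ip_parseval H); auto.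
    - replace (ip (CL (Rn p k q)) (CL g)) with (ip (CL (Rn p k q)) (CL g) + RtoC 0)%C by cring.
      apply Clim_plus; [apply tends_ip, tends_trunc|].
      apply Clim_sq with (fun N => ns (Rn p (N + k) q) * ns g).
      + intro N. replace (ip (Rn p N (Rn p k q)) (Rn p N g) - RtoC 0)%C
          with (ip (Rn p N (Rn p k q)) (Rn p N g)) by cring.
        eapply Rle_trans; [apply cauchy_schwarz|]. rewrite Rn_add.
        apply Rmult_le_compat_l; [apply ns_ge0|]. rewrite (ns_Rn H p N g hn hg).
        assert (h := hCL g hg).
        assert (h2 : 0 <= psum (Cf p g) N).
        { rewrite <- (CLco g hg), <- ns_trunc. apply ns_ge0. }
        lra.
      + apply Rlim_zero_scal. now apply (is_lim_seq_incr_n (fun N => ns (Rn p N q)) k). }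
  assert (CLH : forall g n, fixH H g -> CL (H g) n = ip (Bn n theta) (CL g)).
  { intros g n hg. rewrite <- CLk, <- key by exact hg. unfold q.
    rewrite (ip_Rn_q H p n g hn hg). rewrite CLco by now apply fixH_H. reflexivity. }
  assert (hin : inner2 theta).
  (* Taking [g = q] in [CLH] turns the left side into the quotient of [p] by itself, whose
     coefficients are 1, 0, 0, ..., because [Rp p p] is zero. *)
  { intro k. unfold theta at 2. rewrite <- CLH by exact hq. unfold q. rewrite hp, CLco by exact hp.
    unfold Cf. destruct k as [|k].
    - simpl. now rewrite ip_self, (ni_ns H p hn).
    - rewrite <- Rn_S. replace (Rp p p) with l2zero.
      + replace (Rn p k l2zero) with l2zero; [apply ip_zerol|].
        rewrite <- (l2_zero_scal l2zero) at 2. rewrite Rn_scal. l2ext.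
      + unfold Rp. rewrite ip_self, (ni_ns H p hn). l2ext. }
  destruct (inner_hankel theta hin) as [T [hT hTf]].
  exists theta, T. do 4 (split; [assumption|]). split.
  (* Full isometry of [CL] is known only where [key] applies, so it is propagated from the orbit
     [Rn p k q] to its linear combinations. *)
  - set (Good := fun f => fixH H f /\ forall g, fixH H g -> ip f g = ip (CL f) (CL g)).
    assert (Gadd : forall f g, Good f -> Good g -> Good (f + g)%L2).
    { intros f g [hf hf'] [hg hg']. split; [now apply fixH_add|]. intros x hx.
      rewrite CLadd, !ip_addl, hf', hg' by auto. reflexivity. }
    assert (Gscal : forall a f, Good f -> Good (a * f)%L2).
    { intros a f [hf hf']. split; [now apply fixH_scal|]. intros x hx.
      rewrite CLscal, !ip_scall, hf' by auto. reflexivity. }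
    assert (Gns : forall f, Good f -> ns f = ns (CL f)).
    { intros f [hf hf']. unfold ns. now rewrite hf'. }
    intro h.
    (* Since [CL (Rn p k q) = Bn k theta = T (en k)], this is the preimage of [T (trunc h N)]; the
       conjugates come from antilinearity of [T]. *)
    set (FN := lsum (fun k => (h k)^*%C * Rn p k q)%L2).
    assert (GF : forall N, Good (FN N) /\ CL (FN N) = T (trunc h N)).
    { induction N as [|N [IH1 IH2]].
      - assert (h0 : Good (RtoC 0 * p)%L2).
        { split; [now apply fixH_scal|]. intros g hg. rewrite CLscal, !ip_scall by auto. cring. }
        unfold FN, trunc. simpl. rewrite <- (l2_zero_scal p). split; [exact h0|].
        rewrite CLscal by auto. rewrite (l2_zero_scal p), <- (l2_zero_scal l2zero), (ho_scal T hT).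
        l2ext.
      - assert (h1 : Good (Rn p N q)) by (split; auto).
        unfold FN, trunc in *. simpl. split; [auto|].
        rewrite CLadd by (try apply IH1; now apply fixH_scal).
        rewrite IH2, CLscal, (ho_add T hT), (ho_scal T hT), CLk by auto.
        now rewrite (hankel_en theta T N hTf). }
    assert (hTN : tends (fun N => T (trunc h N)) (T h)) by (apply (tends_ho T); auto; apply tends_trunc).
    destruct (complete FN) as [F hF].
    { intros e he. destruct (tends_cauchy _ _ hTN e he) as [N hN]. exists N. intros i j hi hj.
      specialize (hN i j hi hj). simpl in hN.
      destruct (GF i) as [gi ei], (GF j) as [gj ej].
      rewrite Gns by auto. rewrite CLadd, CLscal, ei, ej by (try apply fixH_scal; auto; try apply gi; apply gj).
      exact hN. }
    assert (hFE : fixH H F) by (apply (fixH_lim H FN); auto; intro k; apply GF).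
    assert (hCLF : CL F = T h).
    { apply (tends_unique (fun N => T (trunc h N))); [|exact hTN].
      apply (tends_dom 1 FN F); [|exact hF]. intro k. destruct (GF k) as [gk ek].
      rewrite <- ek, <- CLscal, <- CLadd by (try apply fixH_scal; auto; apply gk).
      rewrite Rmult_1_l. apply hCL. apply fixH_add; auto; [apply gk|now apply fixH_scal]. }
    exists F. split; [exact hFE|]. split.
    + intro n. rewrite <- hCLF, CLco by exact hFE. now apply (cprod_Cf H).
    + apply Rlim_unique with (fun N => ns (FN N)); [now apply tends_ns|].
      apply is_lim_seq_ext with (fun N => ns (T (trunc h N))); [|now apply tends_ns].
      intro N. destruct (GF N) as [gk ek]. rewrite <- ek. symmetry. now apply Gns.
  (* By [CLH], [T (CL (H F)) = CL (H (H F)) = CL F]. *)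
  - intros F hF. exists (CL (H F)). intro n.
    replace (co (T (CL (H F)))) with (Cf p F); [now apply (cprod_Cf H)|].
    rewrite <- CLco by exact hF. apply functional_extensionality. intro k.
    rewrite hTf, <- CLH by now apply fixH_H. now rewrite hF.
Qed.

(** * Intertwining *)

(** [l2B (T f)] is [T (l2S f)]; by symmetry its pairing with [theta] reduces to that of [T theta],
    the constant 1, with a series without constant term. *)
Lemma T_theta_back theta T f : inner2 theta -> hankel_op T ->
  (forall f n, T f n = ip (Bn n theta) f) -> ip theta (l2B (T f)) = RtoC 0.
Proof.
  intros hi hT hTf.
  rewrite <- (ho_shift T hT), ip_conj, (ho_sym T hT), (hankel_inner theta T hi hTf).
  rewrite ip_S_r. replace (l2B e0) with l2zero by l2ext. rewrite ip_zerol. cring.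
Qed.

(** On the circle, with [g = T f], the backward shift is [(g - g_0)/z], and [theta conj((g - g_0)/z)
    = z (theta conj(g) - conj(g_0) theta)]. [ho_shift] gives this up to the constant term, which
    [T_theta_back] shows to be zero. *)
Lemma T_back theta T f : inner2 theta -> hankel_op T ->
  (forall f n, T f n = ip (Bn n theta) f) ->
  T (l2B (T f)) = l2S (T (T f) - ((T f O)^*)%C * theta)%L2.
Proof.
  intros hi hT hTf.
  assert (hT0 : T e0 = theta) by exact (hankel_en theta T 0 hTf).
  assert (h := Sn_B_split (T f)). apply (f_equal T) in h.
  rewrite (ho_add T hT), (ho_scal T hT), (ho_shift T hT), hT0 in h.
  rewrite h.
  assert (hz : T (l2B (T f)) O = RtoC 0).
  { rewrite <- ip_e0, (ho_sym T hT), hT0. now apply (T_theta_back theta T). }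
  rewrite <- (l2S_B _ hz) at 1. f_equal. l2ext.
Qed.

(** The square of [T] fixes every [Bn k theta], by induction through [T_back]; since coefficients of
    [T] are inner products with these vectors, moving the square across by symmetry gives the
    claim. *)
Lemma TT_range theta T y : inner2 theta -> hankel_op T ->
  (forall f n, T f n = ip (Bn n theta) f) -> T (T (T y)) = T y.
Proof.
  intros hi hT hTf. assert (hth := hankel_inner theta T hi hTf).
  assert (h1 : forall k, T (T (Bn k theta)) = Bn k theta).
  { induction k as [|k IH].
    - change (Bn 0 theta) with theta. rewrite hth. exact (hankel_en theta T 0 hTf).
    - change (Bn (S k) theta) with (l2B (Bn k theta)).
      rewrite <- (hankel_en theta T k hTf) at 1.
      rewrite (T_back theta T (en k) hi hT hTf), (ho_shift T hT).
      rewrite (ho_add T hT), !(ho_scal T hT), hth.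
      rewrite (hankel_en theta T k hTf), IH.
      l2ext. }
  apply L2_eq. intro n. rewrite (hTf (T (T y))), (hTf y).
  rewrite ip_conj, (ho_sym T hT), <- ip_conj, (ho_sym T hT), h1. reflexivity.
Qed.

(** Polarisation: [f + g] gives the real part, and replacing [g] by [i g] the imaginary one.
    Linearity is required only on [K] because multiplication by [p] is controlled only there. *)
Lemma ip_of_ns (mul : L2 -> L2) (K : L2 -> Prop) :
  (forall f g, K f -> K g -> K (f + g)%L2) -> (forall a f, K f -> K (a * f)%L2) ->
  (forall f g, K f -> K g -> mul (f + g)%L2 = (mul f + mul g)%L2) ->
  (forall a f, K f -> mul (a * f)%L2 = (a * mul f)%L2) ->
  (forall f, K f -> ns (mul f) = ns f) ->
  forall f g, K f -> K g -> ip (mul f) (mul g) = ip f g.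
Proof.
  intros Ka Ks ma ms mn.
  assert (hr : forall f g, K f -> K g -> fst (ip (mul f) (mul g)) = fst (ip f g)).
  { intros f g hf hg. assert (h := mn _ (Ka f g hf hg)).
    rewrite ma, !ns_add, !mn in h by assumption. lra. }
  intros f g hf hg. apply injective_projections; [now apply hr|].
  assert (h := hr f (((0, 1) : C) * g)%L2 hf (Ks _ _ hg)).
  rewrite ms, !ip_scalr in h by assumption. simpl in h. lra.
Qed.

Lemma intertwine H theta T (p : L2) : hankel_op H -> inner2 theta -> hankel_op T ->
  (forall f n, T f n = ip (Bn n theta) f) ->
  (forall h, exists F : L2, co F = cprod p (T h) /\ ns F = ns (T h)) ->
  (forall F : L2, fixH H F <-> exists h, co F = cprod p (T h)) ->
  co (H p) = cprod theta p ->
  forall f (F : L2), co F = cprod p (T f) -> co (H F) = cprod p (T (T f)).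
Proof.
  intros hH hi hT hTf hiso hE hp.
  set (K := fun f => exists h, f = T h).
  assert (hT0 : T e0 = theta) by exact (hankel_en theta T 0 hTf).
  assert (hTth := hankel_inner theta T hi hTf).
  assert (Ke : K e0) by (now exists theta).
  assert (Kth : K theta) by (now exists e0).
  assert (KT : forall f, K (T f)) by (intro f; now exists f).
  assert (Ka : forall f g, K f -> K g -> K (f + g)%L2).
  { intros f g [a ->] [b ->]. exists (a + b)%L2. now rewrite (ho_add T hT). }
  assert (Ks : forall a f, K f -> K (a * f)%L2).
  { intros a f [b ->]. exists ((a^*)%C * b)%L2. now rewrite (ho_scal T hT), Cconj_conj. }
  assert (KB : forall f, K f -> K (l2B f)).
  { intros f [a ->]. exists (l2S a). now rewrite (ho_shift T hT). }
  assert (KBn : forall k, K (Bn k theta)) by (induction k; [exact Kth | now apply KB]).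
  (* Outside [K] the product with [p] may fail to be square-summable, so [mul] takes the dummy value
     [f] there. *)
  assert (hm : forall f, exists F : L2, K f -> co F = cprod p f /\ ns F = ns f).
  { intro f. destruct (classic (K f)) as [[h ->]|hf]; [|now exists f].
    destruct (hiso h) as [F hF]. now exists F. }
  apply choice in hm. destruct hm as [mul hmul].
  assert (mco : forall f, K f -> co (mul f) = cprod p f) by (intros; now apply hmul).
  assert (mns : forall f, K f -> ns (mul f) = ns f) by (intros; now apply hmul).
  assert (ma : forall f g, K f -> K g -> mul (f + g)%L2 = (mul f + mul g)%L2).
  { intros f g hf hg. apply L2_eq. intro n. simpl. rewrite !mco by auto. apply cprod_plus_r. }
  assert (ms : forall a f, K f -> mul (a * f)%L2 = (a * mul f)%L2).
  { intros a f hf. apply L2_eq. intro n. simpl. rewrite !mco by auto. apply cprod_scal_r. }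
  assert (mip := ip_of_ns mul K Ka Ks ma ms mns).
  assert (me : mul e0 = p).
  { apply L2_eq. intro n. rewrite mco by exact Ke. apply cprod_e0_r. }
  assert (hp0 : exists m, p m <> RtoC 0).
  { apply NNPP. intro h. assert (hz : p = l2zero).
    { apply L2_eq. intro n. apply NNPP. intro h'. apply h. now exists n. }
    assert (h1 := mns e0 Ke). rewrite me, hz in h1.
    unfold ns in h1. rewrite ip_zerol, ip_e0 in h1. simpl in h1. lra. }
  assert (minj : forall f g, K f -> K g -> (forall n, cprod p f n = cprod p g n) -> f = g).
  { intros f g hf hg h. apply L2_eq. now apply (cprod_inj p). }
  (* The relation [H (p f) = p w] inside the model space; the goal is that it is the graph of [T]
     there. *)
  set (W := fun f w => K f /\ K w /\ H (mul f) = mul w).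
  assert (mE : forall f, K f -> fixH H (mul f)).
  { intros f hf. destruct hf as [h ->] eqn:e. apply hE. exists h. rewrite mco; auto. }
  assert (Wex : forall f, K f -> exists w, W f w).
  { intros f hf. assert (h1 := fixH_H H _ (mE f hf)). apply hE in h1. destruct h1 as [h e].
    exists (T h). split; [exact hf|]. split; [apply KT|]. apply L2_eq. intro n.
    now rewrite mco, e. }
  assert (We : W e0 theta).
  { split; [exact Ke|]. split; [exact Kth|]. rewrite me. apply L2_eq. intro n.
    now rewrite mco, hp, cprod_comm. }
  assert (Wt : W theta e0).
  { split; [exact Kth|]. split; [exact Ke|]. rewrite <- (proj2 (proj2 We)). now apply mE. }
  assert (Wsym : forall f w f' w', W f w -> W f' w' -> ip w f' = ip w' f).
  { intros f w f' w' [h1 [h2 h3]] [h4 [h5 h6]].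
    rewrite <- (mip w f'), <- (mip w' f), <- h3, <- h6 by assumption. apply (ho_sym H hH). }
  (* The analogue of [T_back] for this relation: apply [H] to [p f = f_0 p + z p (f - f_0)/z], then
     cancel [p]. *)
  assert (WB : forall f w, W f w -> W (l2B f) (l2S (w - ((f O)^*)%C * theta)%L2)).
  { intros f w hW. destruct (Wex (l2B f)) as [w1 hW1]; [apply KB, hW|].
    assert (hw : co w1 = co (l2S (w - ((f O)^*)%C * theta)%L2)).
    { apply functional_extensionality. apply (cprod_inj p); [exact hp0|].
      (* Applying [H] determines only the backward shift of [p w1], so the vanishing of this
         constant term is what allows undoing that shift. *)
      assert (h0 : w1 O = RtoC 0).
      { rewrite <- ip_e0, (Wsym _ _ _ _ hW1 We). destruct hW as [[h ->] _].
        now apply (T_theta_back theta T). }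
      destruct hW as [h1 [h2 h3]], hW1 as [h4 [h5 h6]].
      assert (hs : mul f = (f O * p + l2S (mul (l2B f)))%L2).
      { apply L2_eq. intro n. simpl. rewrite !mco by auto.
        rewrite (Sn_B_split f) at 1. simpl. rewrite cprod_plus_r, cprod_scal_r, cprod_e0_r.
        f_equal. change (fun k => shseq (fun n0 => f (S n0)) k) with (shseq (l2B f)).
        rewrite cprod_shseq_r. destruct n; reflexivity. }
      apply (f_equal H) in hs.
      rewrite h3, (ho_add H hH), (ho_scal H hH), (ho_shift H hH), h6 in hs.
      rewrite <- me, (proj2 (proj2 We)) in hs.
      intros [|n].
      - rewrite !cprod_0, h0. simpl. cring.
      - change (co (l2S (w - ((f O)^*)%C * theta)%L2))
          with (shseq (w - ((f O)^*)%C * theta)%L2).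
        rewrite cprod_shseq_r. simpl. rewrite cprod_plus_r, !cprod_scal_r.
        rewrite <- (mco w), <- (mco theta), <- (mco w1) by assumption.
        rewrite hs. simpl. cring. }
    replace (l2S (w - ((f O)^*)%C * theta)%L2) with w1; [exact hW1|].
    apply L2_eq. intro n. now rewrite hw. }
  assert (Wk : forall k, W (Bn k theta) (T (Bn k theta))).
  { induction k as [|k IH].
    - change (Bn 0 theta) with theta. rewrite hTth. exact Wt.
    - apply WB in IH. change (Bn (S k) theta) with (l2B (Bn k theta)).
      replace (T (l2B (Bn k theta))) with (l2S (T (Bn k theta) - ((Bn k theta O)^*)%C * theta)%L2);
        [exact IH|].
      rewrite <- (hankel_en theta T k hTf). symmetry. now apply (T_back theta T). }
  intros f F hF.
  destruct (Wex (T f) (KT f)) as [w hw].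
  set (x := (w - T (T f))%L2).
  (* Coefficient [n] of [T x] is the pairing of [Bn n theta] with [x]; [w] and [T (T f)] pair
     equally with it, by the two symmetries and [Wk]. *)
  assert (hTx : T x = l2zero).
  { apply L2_eq. intro n. rewrite hTf, ip_conj. unfold x.
    rewrite ip_addl, ip_scall, (Wsym _ _ _ _ hw (Wk n)), (ho_sym T hT (Bn n theta)).
    cring. }
  assert (hx : x = l2zero).
  (* [x] lies in the range of [T], where the square of [T] is the identity, so [T x = 0] forces
     [x = 0]. *)
  { assert (Kx : K x) by (apply Ka; [apply hw|apply Ks, KT]).
    destruct Kx as [y e]. rewrite e in *. rewrite <- (TT_range theta T y hi hT hTf), hTx.
    rewrite <- (l2_zero_scal l2zero), (ho_scal T hT). l2ext. }
  assert (hwT : w = T (T f)).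
  { apply L2_eq. intro n. assert (h := f_equal (fun z : L2 => z n) hx). unfold x in h. simpl in h.
    replace (w n) with (w n + RtoC (-1) * T (T f) n + T (T f) n)%C by cring. rewrite h. cring. }
  replace F with (mul (T f)).
  - rewrite (proj2 (proj2 hw)), hwT. now apply mco.
  - apply L2_eq. intro n. now rewrite mco, hF.
Qed.

(** * From sequences to [L2] *)

Lemma H2_L2 f : H2 f <-> exists F : L2, co F = f.
Proof.
  split.
  - intros [l hl]. apply is_series_Reals in hl. now exists (mkL2 f (ex_intro _ l hl)).
  - intros [F <-]. exists (ns F). apply is_series_Reals, ns_is.
Qed.

Lemma infinite_sum_ns (F : L2) l : infinite_sum (fun n => Cnorm2 (F n)) l <-> l = ns F.
Proof.
  rewrite <- is_series_Reals. split.
  - intro h. rewrite <- (is_series_unique _ _ h). apply is_series_unique, ns_is.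
  - intros ->. apply ns_is.
Qed.

Lemma Hankel_ip (u f : L2) g : Hankel u f g <-> g = fun n => ip (Bn n u) f.
Proof.
  assert (h : forall n, isC (fun k => Cmul (u (n + k)%nat) ((f k)^*)%C) (ip (Bn n u) f)).
  { intro n. apply isC_ext with (fun k => Bn n u k * (f k)^*)%C; [|apply ip_isC].
    intro k. now rewrite co_Bn, Nat.add_comm. }
  split.
  - intro hg. apply functional_extensionality. intro n.
    specialize (hg n). apply isC_Cseries in hg. exact (isC_unique _ _ _ hg (h n)).
  - intros -> n. apply isC_Cseries, h.
Qed.

Lemma Hankel_op (u : L2) (H : L2 -> L2) f g :
  (forall f n, H f n = ip (Bn n u) f) -> (Hankel u (co f) g <-> g = co (H f)).
Proof.
  intro hH. rewrite Hankel_ip.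
  replace (fun n => ip (Bn n u) f) with (co (H f)); [tauto|].
  apply functional_extensionality. intro n. apply hH.
Qed.

Lemma BMOA_hankel (u : L2) : BMOA u ->
  exists H, hankel_op H /\ forall f n, H f n = ip (Bn n u) f.
Proof.
  intros [_ [M hM]]. apply (hankel_op_exists u M). intros a N.
  destruct (hM (trunc a N)) as [g [hg hb]]; [now apply H2_L2; exists (trunc a N)|].
  apply Hankel_ip in hg. apply hb.
  - apply infinite_sum_ns. symmetry. apply ns_trunc.
  - replace g with (co (lsum (fun k => (a k)^*%C * Bn k u)%L2 N)).
    + now apply infinite_sum_ns.
    + rewrite hg. apply functional_extensionality. intro n. apply lsum_hankel.
Qed.

Lemma hankel_op_scal H r : hankel_op H -> hankel_op (fun f => RtoC r * H f)%L2.
Proof.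
  intros hH. constructor.
  - intros f g. rewrite (ho_add H hH). l2ext.
  - intros a f. rewrite (ho_scal H hH). l2ext.
  - intros f g. now rewrite !ip_scall, (ho_sym H hH).
  - intros f. rewrite (ho_shift H hH). l2ext.
  - destruct (ho_bdd H hH) as [M hM]. exists (Cnorm2 (RtoC r) * M). intro f.
    rewrite ns_scal, Rmult_assoc. apply Rmult_le_compat_l; [apply Cnorm2_ge0|apply hM].
Qed.

(** As [s] is real, antilinearity introduces no conjugate and the square of [H / s] is the square of
    [H] divided by [s * s]. *)
Lemma EH_fixH (u : L2) (s : R) H f : hankel_op H -> (forall f n, H f n = ip (Bn n u) f) -> 0 < s ->
  (EH u s f <-> exists F, co F = f /\ fixH (fun f => RtoC (/ s) * H f)%L2 F).
Proof.
  intros hH hHu hs. unfold EH, fixH. split.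
  - intros [hf [g [h1 h2]]]. apply H2_L2 in hf. destruct hf as [F <-].
    exists F. split; [reflexivity|].
    apply (Hankel_op u H) in h1; [|exact hHu]. subst g.
    apply (Hankel_op u H) in h2; [|exact hHu].
    rewrite (ho_scal H hH). apply L2_eq. intro n. simpl. rewrite <- h2.
    apply injective_projections; simpl; field; lra.
  - intros [F [<- hF]]. split; [apply H2_L2; now exists F|].
    exists (co (H F)). split; [now apply (Hankel_op u H)|].
    apply (Hankel_op u H); [exact hHu|].
    apply functional_extensionality. intro n.
    rewrite <- hF at 1. rewrite (ho_scal H hH). apply injective_projections; simpl; field; lra.
Qed.

Lemma inner_inner2 (theta : L2) : inner theta <-> inner2 theta.
Proof.
  assert (h : forall k, isC (fun n => Cmul (theta n) ((theta (n + k)%nat)^*)%C) (ip theta (Bn k theta))).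
  { intro k. apply isC_ext with (fun n => theta n * (Bn k theta n)^*)%C; [|apply ip_isC].
    intro n. now rewrite co_Bn. }
  split.
  - intros [_ hi] k. rewrite ip_conj, (isC_unique _ _ _ (h k) (proj2 (isC_Cseries _ _) (hi k))).
    destruct k; cring.
  - intro hi. split; [apply H2_L2; now exists theta|]. intro k. apply isC_Cseries.
    replace (match k with O => C1 | _ => C0 end) with (ip theta (Bn k theta)); [apply h|].
    rewrite ip_conj, hi. destruct k; cring.
Qed.

Lemma RanH_op (theta : L2) (T : L2 -> L2) f : (forall f n, T f n = ip (Bn n theta) f) ->
  (RanH theta f <-> exists h, f = co (T h)).
Proof.
  intro hT. unfold RanH. split.
  - intros [g [hg h]]. apply H2_L2 in hg. destruct hg as [G <-]. exists G.
    now apply (Hankel_op theta T) in h.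
  - intros [h ->]. exists (co h). split; [apply H2_L2; now exists h|].
    now apply (Hankel_op theta T).
Qed.

Theorem mainTheorem1 (u : nat -> Cx) (s : R) :
  BMOA u -> 0 < s ->
  (exists f, EH u s f /\ exists n, f n <> C0) ->
  (exists (theta p : nat -> Cx),
      inner theta /\ H2 p /\ isometric_multiplier p (RanH theta) /\
      (forall f, EH u s f <-> exists h, RanH theta h /\ f = cprod p h) /\
      Hankel u p (fun n => Rscal s (cprod theta p n)))
  /\
  (forall (theta p : nat -> Cx),
      inner theta -> H2 p -> isometric_multiplier p (RanH theta) ->
      (forall f, EH u s f <-> exists h, RanH theta h /\ f = cprod p h) ->
      Hankel u p (fun n => Rscal s (cprod theta p n)) ->
      forall f g, RanH theta f -> Hankel theta f g ->
        Hankel u (cprod p f) (fun n => Rscal s (cprod p g n))).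
Proof.
  intros hu hs hnz.
  destruct (proj1 (H2_L2 u) (proj1 hu)) as [U <-].
  destruct (BMOA_hankel U hu) as [HU [hHU hHUf]].
  set (H := fun f => (RtoC (/ s) * HU f)%L2).
  assert (hH : hankel_op H) by now apply hankel_op_scal.
  assert (hE : forall f, EH U s f <-> exists F, co F = f /\ fixH H F)
    by (intro f; now apply EH_fixH).
  (* Translates statements of the form [H_u F = s a] into [H F = a] for the normalised operator. *)
  assert (hHan : forall (F : L2) (a : nat -> C),
    Hankel U F (fun n => Rscal s (a n)) <-> co (H F) = a).
  { intros F a. rewrite (Hankel_op U HU) by exact hHUf. split; intro h.
    - apply functional_extensionality. intro n. simpl. rewrite <- h.
      apply injective_projections; simpl; field; lra.
    - apply functional_extensionality. intro n. rewrite <- h.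
      apply injective_projections; simpl; field; lra. }
  split.
  - destruct (near_inv_exists H hH) as [p hp].
    { destruct hnz as [f [hf hn]]. apply hE in hf. destruct hf as [F [<- hF]]. now exists F. }
    destruct (near_inv_model H p hp) as [theta [T [hi [hT [hTf [hpth [hran hEr]]]]]]].
    exists (co theta), (co p).
    split; [now apply inner_inner2|]. split; [apply H2_L2; now exists p|].
    split; [|split].
    + intros f hf. apply (RanH_op theta T) in hf; [|exact hTf]. destruct hf as [h ->].
      destruct (hran h) as [F [_ [hF hns]]]. apply functional_extensionality in hF.
      rewrite <- hF. split; [apply H2_L2; now exists F|].
      intros l hl. apply infinite_sum_ns in hl. apply infinite_sum_ns. congruence.
    + intro f. rewrite hE. split.
      * intros [F [<- hF]]. destruct (hEr F hF) as [h e]. exists (co (T h)).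
        split; [apply (RanH_op theta T); [exact hTf|now exists h]|].
        now apply functional_extensionality.
      * intros [k [hk ->]]. apply (RanH_op theta T) in hk; [|exact hTf]. destruct hk as [h ->].
        destruct (hran h) as [F [hF [e _]]]. exists F. split; [|exact hF].
        now apply functional_extensionality.
    + apply hHan. rewrite cprod_comm. apply functional_extensionality. exact hpth.
  - intros th p' hin hp2 hiso hEr hHp f g hf hg.
    apply H2_L2 in hp2. destruct hp2 as [p <-].
    destruct (proj1 (H2_L2 th) (proj1 hin)) as [theta <-].
    apply inner_inner2 in hin.
    destruct (inner_hankel theta hin) as [T [hT hTf]].
    assert (hR := fun f => RanH_op theta T f hTf).
    (* The isometry hypothesis on the given pair, restated for the operator [T] built from its own
       [theta]. *)
    assert (hiso2 : forall h, exists F : L2, co F = cprod p (T h) /\ ns F = ns (T h)).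
    { intro h. destruct (hiso (co (T h))) as [h1 h2]; [apply hR; now exists h|].
      apply H2_L2 in h1. destruct h1 as [F hF]. exists F. split; [exact hF|].
      symmetry. apply infinite_sum_ns. rewrite hF. apply h2. now apply infinite_sum_ns. }
    apply hR in hf. destruct hf as [h ->].
    apply (Hankel_op theta T) in hg; [|exact hTf]. subst g.
    destruct (hiso2 h) as [F [hF _]]. rewrite <- hF. apply hHan.
    apply (intertwine H theta T p hH hin hT hTf hiso2); [| |exact hF].
    + intro G. split.
      * intro hG. destruct (proj1 (hEr (co G))) as [k [hk e]]; [apply hE; now exists G|].
        apply hR in hk. destruct hk as [k' ->]. now exists k'.
      * intros [k e]. destruct (proj1 (hE (co G))) as [G' [e' hG']].
        { apply hEr. exists (co (T k)). split; [apply hR; now exists k|exact e]. }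
        replace G with G'; [exact hG'|]. apply L2_eq. intro n. now rewrite e'.
    + now apply hHan.
Qed.
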